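(* Let $(s,p)$ be a point in $\mathbb C^2$. Then $(s,p)\in b\Gamma$ if and only if $s=\overline{s}p$ and $|s^2-4p|+|s|^2=4$.
   Context: The closed symmetrized bidisc is $\Gamma=\{(z_1+z_2,\,z_1z_2) : z_1,z_2\in\mathbb C,\ |z_1|\leq 1,\ |z_2|\leq 1\}\subset\mathbb C^2$, and $b\Gamma$ denotes its distinguished boundary (the Shilov boundary of $\Gamma$ with respect to the algebra of functions continuous on $\Gamma$ and holomorphic in its interior); it is known that $b\Gamma=\{(z_1+z_2,\,z_1z_2): |z_1|=|z_2|=1\}=\{(s,p)\in\Gamma : |p|=1\}$. *)

(* Defs.v *)
From Stdlib Require Import Reals.
From Coquelicot Require Import Coquelicot.

Open Scope C_scope.

Definition C2 : NormedModule C_AbsRing :=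
  prod_NormedModule C_AbsRing C_NormedModule C_NormedModule.

(* Complex differentiability is Fréchet differentiability with a C-linear
   differential; the scalars of [ex_filterdiff] are those of [C2].
   [locally x K] says that x is an interior point of K. *)
Definition holomorphic_in_interior (K : C2 -> Prop) (f : C2 -> C_NormedModule) : Prop :=
  forall x : C2, locally x K -> ex_filterdiff f (locally x).

(* The algebra A(K).  Its members are represented by total functions, of which
   only the values on K matter. *)
Definition holomorphic_algebra (K : C2 -> Prop) (f : C2 -> C_NormedModule) : Prop :=
  continuous_on K f /\ holomorphic_in_interior K f.

Definition closed_boundary (K : C2 -> Prop) (A : (C2 -> C_NormedModule) -> Prop)
    (E : C2 -> Prop) : Prop :=
  closed E /\ (forall x, E x -> K x) /\
  forall f, A f -> exists x, E x /\ forall y, K y -> (Cmod (f y) <= Cmod (f x))%R.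

(* The smallest closed boundary of the function algebra A on the compact set K.
   By Shilov's theorem, when A separates the points of K, the intersection of
   all closed boundaries is again a closed boundary. *)
Definition shilov_boundary (K : C2 -> Prop) (A : (C2 -> C_NormedModule) -> Prop)
    (x : C2) : Prop :=
  forall E : C2 -> Prop, closed_boundary K A E -> E x.

Definition symmetrized_bidisc (x : C2) : Prop :=
  exists z1 z2 : C, (Cmod z1 <= 1)%R /\ (Cmod z2 <= 1)%R /\ x = (z1 + z2, z1 * z2).

Definition distinguished_boundary : C2 -> Prop :=
  shilov_boundary symmetrized_bidisc (holomorphic_algebra symmetrized_bidisc).

(* Main.v *)
(* Write pi(z1, z2) = (z1 + z2, z1 z2).  The two equations describe the image under pi
   of the torus |z1| = |z2| = 1, so it has to be shown that this image is the smallest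
   closed boundary of A(Gamma).

   It is a closed boundary.  Given f in A(Gamma) and (a, b) in the open bidisc, let m_c
   be the disc automorphism with m_c(0) = c.  The one-variable function
   w |-> f(pi(m_a(w), m_b(w))) is complex differentiable in the unit disc, so by the mean
   value property |f(pi(a, b))| is at most its modulus at some point of the circle of
   radius r; as r -> 1 both m_a(w) and m_b(w) approach the unit circle, and a compactness
   argument on the torus concludes.  Differentials are not assumed continuous, so the mean
   value property comes from Goursat's bisection, carried out in the coordinates
   w = e^(x + iy), where periodicity in y makes the horizontal sides cancel.

   It lies in every closed boundary, because each of its points (s0, p0) is the unique
   maximum point on Gamma of the modulus of
   (16 - conj(p0) (s - s0)^2) (p + p0)^4. *)

Require Import Defs.
From Stdlib Require Import Reals Lra Lia Classical ClassicalEpsilon.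
From Coquelicot Require Import Coquelicot.
Open Scope R_scope.

(** * Goursat's theorem on rectangles *)

(** Every left end lies below every right end, so the supremum of the left ends works. *)
Lemma nested_dyadic_intervals (a : nat -> R) (w : R) :
  0 <= w ->
  (forall n, a n <= a (S n)) ->
  (forall n, a (S n) + w / 2 ^ S n <= a n + w / 2 ^ n) ->
  exists x, forall n, a n <= x <= a n + w / 2 ^ n.
Proof.
intros Hw Hup Hdown.
assert (Hpos : forall n, 0 <= w / 2 ^ n).
{ intros n; apply Rmult_le_pos; [exact Hw | left; apply Rinv_0_lt_compat, pow_lt; lra]. }
assert (Hup' : forall n k, a n <= a (n + k)%nat).
{ intros n k; induction k as [|k IH].
  - rewrite Nat.add_0_r; lra.
  - rewrite Nat.add_succ_r; specialize (Hup (n + k)%nat); lra. }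
assert (Hdown' : forall n k, a (n + k)%nat + w / 2 ^ (n + k) <= a n + w / 2 ^ n).
{ intros n k; induction k as [|k IH].
  - rewrite Nat.add_0_r; lra.
  - rewrite Nat.add_succ_r; specialize (Hdown (n + k)%nat); lra. }
assert (Hcross : forall n m, a m <= a n + w / 2 ^ n).
{ intros n m; destruct (Nat.le_ge_cases n m) as [H|H].
  - replace m with (n + (m - n))%nat by lia.
    specialize (Hdown' n (m - n)%nat); specialize (Hpos (n + (m - n))%nat); lra.
  - specialize (Hup' m (n - m)%nat).
    replace (m + (n - m))%nat with n in Hup' by lia.
    specialize (Hpos n); lra. }
destruct (completeness (fun r => exists n, r = a n)) as [x [Hub Hlub]].
- exists (a 0%nat + w / 2 ^ 0); intros r [n ->]; apply Hcross.
- exists (a 0%nat); now exists 0%nat.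
- exists x; intros n; split.
  + apply Hub; now exists n.
  + apply Hlub; intros r [m ->]; apply Hcross.
Qed.

Lemma pow2_inv_small (c eps : R) : 0 < eps -> exists n, c / 2 ^ n < eps.
Proof.
intros Heps.
destruct (pow_lt_1_zero (/ 2)) with (y := eps / (Rabs c + 1)) as [n Hn].
- rewrite Rabs_pos_eq; lra.
- apply Rdiv_lt_0_compat; [exact Heps | pose proof (Rabs_pos c); lra].
- exists n; specialize (Hn n (le_n n)).
  pose proof (Rabs_pos c) as Hc.
  assert (H2 : 0 < (/ 2) ^ n) by (apply pow_lt; lra).
  rewrite Rabs_pos_eq in Hn by lra.
  unfold Rdiv; rewrite <- pow_inv.
  apply Rmult_lt_compat_l with (r := Rabs c + 1) in Hn; [|lra].
  replace ((Rabs c + 1) * (eps / (Rabs c + 1))) with eps in Hn by (field; lra).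
  pose proof (Rle_abs c) as Hcc.
  assert (c * (/ 2) ^ n <= (Rabs c + 1) * (/ 2) ^ n) by (apply Rmult_le_compat_r; lra).
  lra.
Qed.

(** Bisection: if [P] failed on the whole rectangle, it would fail on a quarter of it, and so on;
    the quarters shrink to a point, where the local hypothesis is contradicted. The equation in that
    hypothesis records that the pieces keep the proportions of the whole, which lets Goursat's
    argument compare perimeter and area. The lemma also serves for compactness of the torus. *)
Lemma rectangle_induction (P : R -> R -> R -> R -> Prop) (a b c d : R) :
  a <= b -> c <= d ->
  (forall x1 m x2 y1 y2, a <= x1 <= m -> m <= x2 <= b -> c <= y1 <= y2 -> y2 <= d ->
    P x1 m y1 y2 -> P m x2 y1 y2 -> P x1 x2 y1 y2) ->
  (forall x1 x2 y1 m y2, a <= x1 <= x2 -> x2 <= b -> c <= y1 <= m -> m <= y2 <= d ->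
    P x1 x2 y1 m -> P x1 x2 m y2 -> P x1 x2 y1 y2) ->
  (forall u v, a <= u <= b -> c <= v <= d -> exists delta, 0 < delta /\
    forall x1 x2 y1 y2, a <= x1 <= u -> u <= x2 <= b -> c <= y1 <= v -> v <= y2 <= d ->
    x2 - x1 < delta -> y2 - y1 < delta ->
    (x2 - x1) * (d - c) = (y2 - y1) * (b - a) -> P x1 x2 y1 y2) ->
  P a b c d.
Proof.
intros Hab Hcd Hx Hy Hloc.
set (w := fun n => (b - a) / 2 ^ n).
set (h := fun n => (d - c) / 2 ^ n).
assert (Hpow : forall n, 0 < 2 ^ n) by (intros n; apply pow_lt; lra).
assert (Hw : forall n, 0 <= w n).
{ intros n; apply Rmult_le_pos; [lra | left; apply Rinv_0_lt_compat, Hpow]. }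
assert (Hh : forall n, 0 <= h n).
{ intros n; apply Rmult_le_pos; [lra | left; apply Rinv_0_lt_compat, Hpow]. }
assert (HwS : forall n, w n = w (S n) + w (S n)).
{ intros n; unfold w; simpl; field; specialize (Hpow n); lra. }
assert (HhS : forall n, h n = h (S n) + h (S n)).
{ intros n; unfold h; simpl; field; specialize (Hpow n); lra. }
apply NNPP; intros Hnot.
set (bad := fun n (q : R * R) => a <= fst q /\ fst q + w n <= b /\
  c <= snd q /\ snd q + h n <= d /\
  ~ P (fst q) (fst q + w n) (snd q) (snd q + h n)).
set (next := fun n (q q' : R * R) => bad (S n) q' /\
  fst q <= fst q' /\ fst q' + w (S n) <= fst q + w n /\
  snd q <= snd q' /\ snd q' + h (S n) <= snd q + h n).
assert (Hnext : forall n q, bad n q -> exists q', next n q q').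
{ intros n [x y] (B1 & B2 & B3 & B4 & B5); simpl in *.
  apply NNPP; intros Hno; apply B5.
  assert (Hsub : forall x' y', x <= x' -> x' + w (S n) <= x + w n ->
    y <= y' -> y' + h (S n) <= y + h n -> P x' (x' + w (S n)) y' (y' + h (S n))).
  { intros x' y' H1 H2 H3 H4; apply NNPP; intros HP; apply Hno; exists (x', y').
    unfold next, bad; simpl; repeat split; auto; lra. }
  specialize (Hw (S n)); specialize (Hh (S n)); specialize (HwS n); specialize (HhS n).
  assert (HwE : x + w n = x + w (S n) + w (S n)) by lra.
  assert (HhE : y + h n = y + h (S n) + h (S n)) by lra.
  (* Cutting in [x] and then each half in [y] yields [P] on the parent from its four quarters. *)
  apply Hx with (m := x + w (S n)); try lra;
  apply Hy with (m := y + h (S n)); try lra;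
  rewrite ?HwE, ?HhE; apply Hsub; lra. }
(* In [epsilon], [(a, c)] only witnesses inhabitation; [Hnext] guarantees that a genuine bad quarter
   is picked. *)
set (q := fix q n := match n with
  | O => (a, c)
  | S k => epsilon (inhabits (a, c)) (next k (q k)) end).
assert (Hbad : forall n, bad n (q n)).
{ induction n as [|n IH].
  - unfold bad, w, h; simpl.
    replace (a + (b - a) / 1) with b by field.
    replace (c + (d - c) / 1) with d by field.
    repeat split; auto; lra.
  - exact (proj1 (epsilon_spec (inhabits (a, c)) _ (Hnext n (q n) IH))). }
assert (Hstep : forall n, next n (q n) (q (S n))).
{ intros n; exact (epsilon_spec (inhabits (a, c)) _ (Hnext n (q n) (Hbad n))). }
destruct (nested_dyadic_intervals (fun n => fst (q n)) (b - a)) as [u Hu].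
{ lra. }
{ intros n; apply (Hstep n). }
{ intros n; apply (Hstep n). }
destruct (nested_dyadic_intervals (fun n => snd (q n)) (d - c)) as [v Hv].
{ lra. }
{ intros n; apply (Hstep n). }
{ intros n; apply (Hstep n). }
destruct (Hbad 0%nat) as (B1 & B2 & B3 & B4 & _).
pose proof (Hu 0%nat) as Hu0; pose proof (Hv 0%nat) as Hv0.
unfold w, h in *; simpl in B1, B2, B3, B4, Hu0, Hv0.
destruct (Hloc u v) as [delta [Hdelta HP]]; try lra.
destruct (pow2_inv_small ((b - a) + (d - c)) delta Hdelta) as [n Hn].
destruct (Hbad n) as (C1 & C2 & C3 & C4 & C5).
specialize (Hu n); specialize (Hv n); specialize (Hw n); specialize (Hh n).
apply C5.
replace (((b - a) + (d - c)) / 2 ^ n) with ((b - a) / 2 ^ n + (d - c) / 2 ^ n) in Hn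
  by (field; specialize (Hpow n); lra).
apply HP; try lra.
Qed.

(** The counterclockwise integral of [U dy + V dx] along the boundary, that is, the imaginary part
    of the contour integral of [U + iV]. Green's formula would turn it into the integral of
    [U_x - V_y]. *)
Definition flux (U V : R -> R -> R) (a b c d : R) : R :=
  RInt (fun t => U b t - U a t) c d - RInt (fun t => V t d - V t c) a b.

Lemma ex_RInt_continuous_on (f : R -> R) (a b : R) :
  a <= b -> (forall t, a <= t <= b -> continuous f t) -> ex_RInt f a b.
Proof.
intros Hab Hf; apply (@ex_RInt_continuous R_CompleteNormedModule).
rewrite Rmin_left, Rmax_right by lra; exact Hf.
Qed.

Lemma RInt_Rminus (f g : R -> R) (a b : R) :
  ex_RInt f a b -> ex_RInt g a b ->
  RInt (fun t => f t - g t) a b = RInt f a b - RInt g a b.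
Proof. exact (@RInt_minus R_CompleteNormedModule f g a b). Qed.

Lemma ex_RInt_Rminus (f g : R -> R) (a b : R) :
  ex_RInt f a b -> ex_RInt g a b -> ex_RInt (fun t => f t - g t) a b.
Proof. exact (@ex_RInt_minus R_NormedModule f g a b). Qed.

Lemma RInt_Rplus_Chasles (f : R -> R) (a b c : R) :
  ex_RInt f a b -> ex_RInt f b c -> RInt f a b + RInt f b c = RInt f a c.
Proof. exact (@RInt_Chasles R_CompleteNormedModule f a b c). Qed.

Section Goursat.

Variables (U V : R -> R -> R) (a b c d : R).

Hypothesis U_continuous : forall x y, a <= x <= b -> c <= y <= d -> continuous (U x) y.
Hypothesis V_continuous :
  forall x y, a <= x <= b -> c <= y <= d -> continuous (fun t => V t y) x.

Let exU x y1 y2 : a <= x <= b -> c <= y1 <= y2 -> y2 <= d -> ex_RInt (U x) y1 y2.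
Proof.
intros H1 H2 H3; apply ex_RInt_continuous_on; [lra|].
intros t Ht; apply U_continuous; lra.
Qed.

Let exV y x1 x2 : c <= y <= d -> a <= x1 <= x2 -> x2 <= b -> ex_RInt (fun t => V t y) x1 x2.
Proof.
intros H1 H2 H3; apply ex_RInt_continuous_on; [lra|].
intros t Ht; apply V_continuous; lra.
Qed.

Lemma flux_four_sides x1 x2 y1 y2 :
  a <= x1 <= x2 -> x2 <= b -> c <= y1 <= y2 -> y2 <= d ->
  flux U V x1 x2 y1 y2 = RInt (U x2) y1 y2 - RInt (U x1) y1 y2 -
    (RInt (fun t => V t y2) x1 x2 - RInt (fun t => V t y1) x1 x2).
Proof.
intros H1 H2 H3 H4; unfold flux.
rewrite (RInt_Rminus (U x2) (U x1)) by (apply exU; lra).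
rewrite (RInt_Rminus (fun t => V t y2) (fun t => V t y1)) by (apply exV; lra).
reflexivity.
Qed.

Lemma flux_add_x x1 m x2 y1 y2 :
  a <= x1 <= m -> m <= x2 <= b -> c <= y1 <= y2 -> y2 <= d ->
  flux U V x1 x2 y1 y2 = flux U V x1 m y1 y2 + flux U V m x2 y1 y2.
Proof.
intros H1 H2 H3 H4; rewrite !flux_four_sides by lra.
rewrite <- (RInt_Rplus_Chasles (fun t => V t y1) x1 m x2) by (apply exV; lra).
rewrite <- (RInt_Rplus_Chasles (fun t => V t y2) x1 m x2) by (apply exV; lra).
ring.
Qed.

Lemma flux_add_y x1 x2 y1 m y2 :
  a <= x1 <= x2 -> x2 <= b -> c <= y1 <= m -> m <= y2 <= d ->
  flux U V x1 x2 y1 y2 = flux U V x1 x2 y1 m + flux U V x1 x2 m y2.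
Proof.
intros H1 H2 H3 H4; rewrite !flux_four_sides by lra.
rewrite <- (RInt_Rplus_Chasles (U x1) y1 m y2) by (apply exU; lra).
rewrite <- (RInt_Rplus_Chasles (U x2) y1 m y2) by (apply exU; lra).
ring.
Qed.

Lemma RInt_near_const (f : R -> R) (x y k e : R) :
  x <= y -> ex_RInt f x y -> (forall t, x <= t <= y -> Rabs (f t - k) <= e) ->
  Rabs (RInt f x y - (y - x) * k) <= (y - x) * e.
Proof.
intros Hxy Hf Hb.
assert (Hk : ex_RInt (fun _ : R => k) x y) by apply ex_RInt_const.
replace (RInt f x y - (y - x) * k) with (RInt (fun t => f t - k) x y).
- apply abs_RInt_le_const; auto; now apply ex_RInt_Rminus.
- rewrite RInt_Rminus by assumption.
  rewrite RInt_const; reflexivity.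
Qed.

(* The linear part of (U, V) at a point has no flux because the coefficient [l]
   is shared: it contributes the area times [l - l]. *)
Lemma flux_small u v l my mx e x1 x2 y1 y2 :
  (forall x y, x1 <= x <= x2 -> y1 <= y <= y2 ->
    Rabs (U x y - U u v - (l * (x - u) + my * (y - v))) <= e) ->
  (forall x y, x1 <= x <= x2 -> y1 <= y <= y2 ->
    Rabs (V x y - V u v - (mx * (x - u) + l * (y - v))) <= e) ->
  a <= x1 <= x2 -> x2 <= b -> c <= y1 <= y2 -> y2 <= d ->
  Rabs (flux U V x1 x2 y1 y2) <= 2 * e * ((x2 - x1) + (y2 - y1)).
Proof.
intros HU HV H1 H2 H3 H4; unfold flux.
assert (A : Rabs (RInt (fun t => U x2 t - U x1 t) y1 y2 - (y2 - y1) * (l * (x2 - x1)))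
  <= (y2 - y1) * (2 * e)).
{ apply RInt_near_const; [lra| |].
  - apply ex_RInt_Rminus; apply exU; lra.
  - intros t Ht; pose proof (HU x1 t) as E1; pose proof (HU x2 t) as E2.
    apply Rabs_le.
    specialize (E1 ltac:(lra) Ht); specialize (E2 ltac:(lra) Ht).
    apply Rabs_le_between in E1; apply Rabs_le_between in E2; lra. }
assert (B : Rabs (RInt (fun t => V t y2 - V t y1) x1 x2 - (x2 - x1) * (l * (y2 - y1)))
  <= (x2 - x1) * (2 * e)).
{ apply RInt_near_const; [lra| |].
  - apply ex_RInt_Rminus; apply exV; lra.
  - intros t Ht; pose proof (HV t y1) as E1; pose proof (HV t y2) as E2.
    apply Rabs_le.
    specialize (E1 Ht ltac:(lra)); specialize (E2 Ht ltac:(lra)).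
    apply Rabs_le_between in E1; apply Rabs_le_between in E2; lra. }
apply Rabs_le_between in A; apply Rabs_le_between in B; apply Rabs_le; lra.
Qed.

Hypothesis U_V_differentiable : forall u v, a <= u <= b -> c <= v <= d ->
  exists l my mx, differentiable_pt_lim U u v l my /\ differentiable_pt_lim V u v mx l.

(** For each [eps], bisection bounds the flux by [eps] times the area, so it vanishes. The shared
    coefficient [l] is the Cauchy-Riemann equation [U_x = V_y]. *)
Theorem goursat : a < b -> c < d -> flux U V a b c d = 0.
Proof.
intros Hab Hcd.
(* A rectangle with the proportions of the whole one satisfies [(width + height)^2 = k * area]. *)
set (k := ((b - a) + (d - c)) / (d - c) * (((b - a) + (d - c)) / (b - a))).
assert (Hk : 0 < k).
{ apply Rmult_lt_0_compat; apply Rdiv_lt_0_compat; lra. }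
assert (Hmain : forall eps, 0 < eps ->
  Rabs (flux U V a b c d) <= eps * ((b - a) * (d - c))).
{ intros eps Heps.
  apply (rectangle_induction (fun x1 x2 y1 y2 =>
    Rabs (flux U V x1 x2 y1 y2) <= eps * ((x2 - x1) * (y2 - y1)))); try lra.
  - intros x1 m x2 y1 y2 H1 H2 H3 H4 A B.
    rewrite (flux_add_x x1 m x2) by lra.
    eapply Rle_trans; [apply Rabs_triang|]; lra.
  - intros x1 x2 y1 m y2 H1 H2 H3 H4 A B.
    rewrite (flux_add_y x1 x2 y1 m y2) by lra.
    eapply Rle_trans; [apply Rabs_triang|]; lra.
  - intros u v Hu Hv.
    destruct (U_V_differentiable u v Hu Hv) as (l & my & mx & DU & DV).
    (* With this tolerance the bound of [flux_small] is [2 * (eps / (2 * k)) * (width + height)^2],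
       which is [eps] times the area. *)
    assert (He : 0 < eps / (2 * k)) by (apply Rdiv_lt_0_compat; lra).
    destruct (DU (mkposreal _ He)) as [d1 D1]; destruct (DV (mkposreal _ He)) as [d2 D2].
    exists (Rmin d1 d2); split; [apply Rmin_pos; apply cond_pos|].
    intros x1 x2 y1 y2 H1 H2 H3 H4 Hx Hy Hratio.
    assert (Hd1 := Rmin_l d1 d2); assert (Hd2 := Rmin_r d1 d2).
    set (W := (x2 - x1) + (y2 - y1)).
    assert (Hclose : forall x y, x1 <= x <= x2 -> y1 <= y <= y2 ->
      Rabs (x - u) <= W /\ Rabs (y - v) <= W /\
      Rabs (x - u) < Rmin d1 d2 /\ Rabs (y - v) < Rmin d1 d2).
    { intros x y Hxx Hyy; unfold W.
      repeat split; first [apply Rabs_le | apply Rabs_lt_between]; lra. }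
    assert (Hflux : Rabs (flux U V x1 x2 y1 y2) <= 2 * (eps / (2 * k) * W) * W).
    { apply flux_small with (u := u) (v := v) (l := l) (my := my) (mx := mx); try lra;
      intros x y Hxx Hyy; destruct (Hclose x y Hxx Hyy) as (K1 & K2 & K3 & K4).
      - eapply Rle_trans; [apply D1; lra|].
        apply Rmult_le_compat_l; [simpl; lra | now apply Rmax_lub].
      - eapply Rle_trans; [apply D2; lra|].
        apply Rmult_le_compat_l; [simpl; lra | now apply Rmax_lub]. }
    eapply Rle_trans; [exact Hflux|].
    assert (HW : W * W = k * ((x2 - x1) * (y2 - y1))).
    { assert (Ex : x2 - x1 = (y2 - y1) * ((b - a) / (d - c))).
      { apply Rmult_eq_reg_r with (d - c); [|lra]; rewrite Hratio; field; lra. }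
      unfold W, k; rewrite Ex; field; lra. }
    replace (2 * (eps / (2 * k) * W) * W) with (eps / k * (W * W)) by (field; lra).
    rewrite HW; right; field; lra. }
destruct (Req_dec (flux U V a b c d) 0) as [E|E]; [exact E|exfalso].
apply Rabs_pos_lt in E.
assert (HA : 0 < (b - a) * (d - c)) by (apply Rmult_lt_0_compat; lra).
specialize (Hmain (Rabs (flux U V a b c d) / 2 / ((b - a) * (d - c)))).
replace (Rabs (flux U V a b c d) / 2 / ((b - a) * (d - c)) * ((b - a) * (d - c)))
  with (Rabs (flux U V a b c d) / 2) in Hmain by (field; lra).
assert (0 < Rabs (flux U V a b c d) / 2 / ((b - a) * (d - c))).
{ apply Rdiv_lt_0_compat; lra. }
specialize (Hmain H); lra.
Qed.

End Goursat.

(** * The mean value property *)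

Definition complex_differentiable (g : C -> C) (z : C) : Prop :=
  @ex_filterdiff C_AbsRing C_NormedModule C_NormedModule g
    (@locally C_UniformSpace z).

Lemma is_filter_lim_locally_self (T : UniformSpace) (x : T) : is_filter_lim (locally x) x.
Proof. exact (fun P HP => HP). Qed.

Lemma Rmax_le_both (x y z : R) : Rmax x y <= z -> x <= z /\ y <= z.
Proof. pose proof (Rmax_l x y); pose proof (Rmax_r x y); lra. Qed.

(** C-linearity makes the differential multiplication by its value [(l, m)] at 1, so the partial
    derivatives of the real and imaginary parts share [l] and [m]. *)
Lemma cauchy_riemann (g : C -> C) (x y : R) :
  complex_differentiable g (x, y) ->
  exists l m,
    differentiable_pt_lim (fun u v => Re (g (u, v))) x y l (- m) /\
    differentiable_pt_lim (fun u v => Im (g (u, v))) x y m l.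
Proof.
intros [L [HL HD]].
specialize (HD (x, y) (is_filter_lim_locally_self _ _)).
assert (HLs : forall h : C, L h = Cmult h (L (RtoC 1))).
{ intros h. transitivity (L (Cmult h (RtoC 1))).
  - now rewrite Cmult_1_r.
  - exact (linear_scal L HL h (RtoC 1)). }
destruct (L (RtoC 1)) as [l m] eqn:E.
exists l, m.
assert (Hest : forall eps : posreal, locally_2d (fun u v =>
  Cmod (Cminus (Cminus (g (u, v)) (g (x, y))) (Cmult (Cminus (u, v) (x, y)) (l, m)))
   <= eps * Rmax (Rabs (u - x)) (Rabs (v - y))) x y).
{ intros eps.
  (* [differentiable_pt_lim] measures increments in the maximum norm, which the modulus exceeds by
     at most the factor [sqrt 2]. *)
  assert (Hs : 0 < sqrt 2) by (apply sqrt_lt_R0; lra).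
  assert (He : 0 < eps / sqrt 2) by (apply Rdiv_lt_0_compat; [apply cond_pos | exact Hs]).
  destruct (HD (mkposreal _ He)) as [d Hd].
  exists d; intros u v Hu Hv.
  specialize (Hd (u, v) (conj Hu Hv)).
  change (Cmod (Cminus (Cminus (g (u, v)) (g (x, y))) (L (Cminus (u, v) (x, y))))
    <= eps / sqrt 2 * Cmod (Cminus (u, v) (x, y))) in Hd.
  rewrite HLs in Hd.
  eapply Rle_trans; [exact Hd|].
  pose proof (Cmod_2Rmax (Cminus (u, v) (x, y))) as Hm; simpl in Hm.
  apply Rle_trans with (eps / sqrt 2 * (sqrt 2 * Rmax (Rabs (u - x)) (Rabs (v - y)))).
  - apply Rmult_le_compat_l; [lra | exact Hm].
  - right; field; lra. }
split; intros eps; destruct (Hest eps) as [d Hd]; exists d; intros u v Hu Hv;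
  specialize (Hd u v Hu Hv); (eapply Rle_trans; [|exact Hd]);
  pose proof (Rmax_Cmod (Cminus (Cminus (g (u, v)) (g (x, y)))
    (Cmult (Cminus (u, v) (x, y)) (l, m)))) as Hm;
  apply Rmax_le_both in Hm; destruct Hm as [Hm1 Hm2].
- eapply Rle_trans; [|exact Hm1]; right; f_equal; simpl; unfold Re; ring.
- eapply Rle_trans; [|exact Hm2]; right; f_equal; simpl; unfold Im; ring.
Qed.

Lemma differentiable_pt_lim_Rmult (x y : R) : differentiable_pt_lim Rmult x y y x.
Proof.
intros eps; exists eps; intros u v Hu Hv.
replace (u * v - x * y - (y * (u - x) + x * (v - y))) with ((u - x) * (v - y)) by ring.
rewrite Rabs_mult; apply Rmult_le_compat; try apply Rabs_pos; [lra | apply Rmax_r].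
Qed.

Lemma differentiable_pt_lim_snd (f : R -> R) (x y l : R) :
  derivable_pt_lim f y l -> differentiable_pt_lim (fun _ v => f v) x y 0 l.
Proof.
intros Hf.
assert (Hid : differentiable_pt_lim (fun _ v : R => v) x y 0 1).
{ intros eps; exists (mkposreal 1 Rlt_0_1); intros u v _ _.
  replace (v - y - (0 * (u - x) + 1 * (v - y))) with 0 by ring.
  rewrite Rabs_R0; apply Rmult_le_pos; [left; apply cond_pos|].
  eapply Rle_trans; [apply Rabs_pos | apply Rmax_l]. }
pose proof (differentiable_pt_lim_comp (fun u _ => f u) (fun _ v => v) (fun _ v => v)
  x y l 0 0 1 0 1 (differentiable_pt_lim_proj1_0 f y y l Hf) Hid Hid) as H.
replace 0 with (l * 0 + 0 * 0) by ring.
replace l with (l * 1 + 0 * 1) at 2 by ring.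
exact H.
Qed.

(** * Polar coordinates through the complex exponential *)

Definition polar (x y : R) : C := (exp x * cos y, exp x * sin y).

Lemma polar_differentiable (x y : R) :
  differentiable_pt_lim (fun u v => exp u * cos v) x y (exp x * cos y) (- (exp x * sin y)) /\
  differentiable_pt_lim (fun u v => exp u * sin v) x y (exp x * sin y) (exp x * cos y).
Proof.
assert (He := differentiable_pt_lim_proj1_0 exp x y _ (derivable_pt_lim_exp x)).
assert (Hc := differentiable_pt_lim_snd cos x y _ (derivable_pt_lim_cos y)).
assert (Hs := differentiable_pt_lim_snd sin x y _ (derivable_pt_lim_sin y)).
split.
- pose proof (differentiable_pt_lim_comp _ _ _ _ _ _ _ _ _ _ _
    (differentiable_pt_lim_Rmult (exp x) (cos y)) He Hc) as H.
  replace (exp x * cos y) with (cos y * exp x + exp x * 0) by ring.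
  replace (- (exp x * sin y)) with (cos y * 0 + exp x * - sin y) by ring.
  exact H.
- pose proof (differentiable_pt_lim_comp _ _ _ _ _ _ _ _ _ _ _
    (differentiable_pt_lim_Rmult (exp x) (sin y)) He Hs) as H.
  replace (exp x * sin y) with (sin y * exp x + exp x * 0) by ring.
  replace (exp x * cos y) with (sin y * 0 + exp x * cos y) by ring.
  exact H.
Qed.

Lemma Cmod_polar (x y : R) : Cmod (polar x y) = exp x.
Proof.
unfold Cmod, polar; simpl fst; simpl snd.
replace ((exp x * cos y) ^ 2 + (exp x * sin y) ^ 2) with (exp x * exp x).
- apply sqrt_square; left; apply exp_pos.
- pose proof (sin2_cos2 y) as H; unfold Rsqr in H.
  replace ((exp x * cos y) ^ 2 + (exp x * sin y) ^ 2)
    with (exp x * exp x * (sin y * sin y + cos y * cos y)) by ring.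
  rewrite H; ring.
Qed.

Lemma differentiable_pt_lim_continuous (f : R -> R -> R) (x y lx ly : R) :
  differentiable_pt_lim f x y lx ly ->
  continuous (f x) y /\ continuous (fun t => f t y) x.
Proof.
intros Hf.
assert (Hc : continuity_2d_pt f x y).
{ apply differentiable_continuity_pt; exists lx, ly; exact Hf. }
split; apply filterlim_locally; intros eps; destruct (Hc eps) as [d Hd];
  exists d; intros t Ht; apply Hd; try exact Ht;
  rewrite Rminus_diag, Rabs_R0; apply cond_pos.
Qed.

Lemma polar_cauchy_riemann (g : C -> C) (x y : R) :
  complex_differentiable g (polar x y) ->
  exists l m,
    differentiable_pt_lim (fun u v => Re (g (polar u v))) x y l (- m) /\
    differentiable_pt_lim (fun u v => Im (g (polar u v))) x y m l.
Proof.
intros Hg; destruct (cauchy_riemann g _ _ Hg) as (l & m & H1 & H2).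
destruct (polar_differentiable x y) as [Hc Hs].
(* Chain rule: these are the real and imaginary parts of [(l + im) e^(x + iy)]. *)
exists (l * (exp x * cos y) - m * (exp x * sin y)), (m * (exp x * cos y) + l * (exp x * sin y)).
split.
- pose proof (differentiable_pt_lim_comp _ _ _ _ _ _ _ _ _ _ _ H1 Hc Hs) as H.
  replace (l * (exp x * cos y) - m * (exp x * sin y))
    with (l * (exp x * cos y) + - m * (exp x * sin y)) by ring.
  replace (- (m * (exp x * cos y) + l * (exp x * sin y)))
    with (l * - (exp x * sin y) + - m * (exp x * cos y)) by ring.
  exact H.
- pose proof (differentiable_pt_lim_comp _ _ _ _ _ _ _ _ _ _ _ H2 Hc Hs) as H.
  replace (l * (exp x * cos y) - m * (exp x * sin y))
    with (m * - (exp x * sin y) + l * (exp x * cos y)) by ring.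
  exact H.
Qed.

(** Apply [goursat] on [[a, b] x [0, 2 PI]]: the horizontal sides cancel by periodicity, so the two
    vertical sides, which are circles about 0, carry equal integrals. *)
Lemma polar_mean_constant (g : C -> C) (a b : R) :
  (forall w, Cmod w < 1 -> complex_differentiable g w) ->
  a < b < 0 ->
  RInt (fun t => Re (g (polar a t))) 0 (2 * PI) =
  RInt (fun t => Re (g (polar b t))) 0 (2 * PI).
Proof.
intros Hg Hab.
assert (Hpi := PI_RGT_0).
assert (Hpol : forall x y, x <= b -> complex_differentiable g (polar x y)).
{ intros x y Hx; apply Hg; rewrite Cmod_polar, <- exp_0; apply exp_increasing; lra. }
assert (HU : forall x y, a <= x <= b -> 0 <= y <= 2 * PI ->
  continuous (fun t => Re (g (polar x t))) y).
{ intros x y Hx _; destruct (polar_cauchy_riemann g x y) as (l & m & H1 & H2).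
  - apply Hpol; lra.
  - exact (proj1 (differentiable_pt_lim_continuous _ _ _ _ _ H1)). }
assert (HV : forall x y, a <= x <= b -> 0 <= y <= 2 * PI ->
  continuous (fun t => Im (g (polar t y))) x).
{ intros x y Hx _; destruct (polar_cauchy_riemann g x y) as (l & m & H1 & H2).
  - apply Hpol; lra.
  - exact (proj2 (differentiable_pt_lim_continuous _ _ _ _ _ H2)). }
pose proof (goursat (fun x y => Re (g (polar x y))) (fun x y => Im (g (polar x y)))
  a b 0 (2 * PI) HU HV) as HJ.
rewrite (flux_four_sides _ _ a b 0 (2 * PI) HU HV) in HJ by lra.
replace (RInt (fun t => Im (g (polar t (2 * PI)))) a b)
  with (RInt (fun t => Im (g (polar t 0))) a b) in HJ.
- rewrite Rminus_diag in HJ.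
  assert (E : forall r s : R, r - s - 0 = 0 -> s = r) by (intros; lra).
  apply E, HJ; try lra.
  intros u v Hu _; destruct (polar_cauchy_riemann g u v) as (l & m & H1 & H2).
  + apply Hpol; lra.
  + exists l, (- m), m; now split.
- apply RInt_ext; intros t _; unfold polar.
  now rewrite cos_2PI, sin_2PI, cos_0, sin_0.
Qed.

(** If [Re g] stayed below its value [c] at 0 on the circle of radius [r], its mean [k] there would
    be less than [c]. By continuity [Re g > k] near 0, so a small circle has a mean above [k],
    although the means do not depend on the radius. *)
Lemma Re_le_on_circle (g : C -> C) (r : R) :
  (forall w, Cmod w < 1 -> complex_differentiable g w) ->
  0 < r < 1 -> exists w, Cmod w = r /\ Re (g (RtoC 0)) <= Re (g w).
Proof.
intros Hg Hr; apply NNPP; intros Hno.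
assert (Hpi := PI_RGT_0).
set (b := ln r).
assert (Hb : b < 0) by (unfold b; rewrite <- ln_1; apply ln_increasing; lra).
assert (HU : forall x t, x < 0 -> continuous (fun t => Re (g (polar x t))) t).
{ intros x t Hx; destruct (polar_cauchy_riemann g x t) as (l & m & H1 & H2).
  - apply Hg; rewrite Cmod_polar, <- exp_0; now apply exp_increasing.
  - exact (proj1 (differentiable_pt_lim_continuous _ _ _ _ _ H1)). }
set (c := Re (g (RtoC 0))).
assert (Hlt : RInt (fun t => Re (g (polar b t))) 0 (2 * PI) < 2 * PI * c).
{ replace (2 * PI * c) with (RInt (fun _ : R => c) 0 (2 * PI)).
  - apply RInt_lt; [lra | intros; apply continuous_const | intros; now apply HU |].
    intros t _; apply Rnot_le_lt; intros Hle; apply Hno.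
    exists (polar b t); split; [|exact Hle].
    rewrite Cmod_polar; apply exp_ln; lra.
  - rewrite RInt_const; unfold scal; simpl; unfold mult; simpl; ring. }
set (I := RInt (fun t => Re (g (polar b t))) 0 (2 * PI)) in *.
set (k := I / (2 * PI)).
assert (HI : I = 2 * PI * k).
{ assert (E : forall x : R, x = 2 * PI * (x / (2 * PI))) by (intros; field; lra).
  exact (E I). }
assert (Hkc : k < c) by (rewrite HI in Hlt; apply Rmult_lt_reg_l in Hlt; lra).
assert (Hcont : exists d, 0 < d /\ forall w, Cmod w < d -> k < Re (g w)).
{ destruct (cauchy_riemann g 0 0) as (l & m & H1 & _).
  - apply Hg; change (0, 0) with (RtoC 0); rewrite Cmod_0; lra.
  - assert (Hc : continuity_2d_pt (fun u v => Re (g (u, v))) 0 0).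
    { apply differentiable_continuity_pt; exists l, (- m); exact H1. }
    assert (Hpos : 0 < c - k) by lra.
    destruct (Hc (mkposreal _ Hpos)) as [d Hd].
    exists d; split; [apply cond_pos|]; intros [u v] Hw.
    pose proof (Rmax_Cmod (u, v)) as Hm; apply Rmax_le_both in Hm; simpl in Hm.
    specialize (Hd u v); rewrite !Rminus_0_r in Hd.
    specialize (Hd ltac:(lra) ltac:(lra)); simpl in Hd.
    apply Rabs_lt_between in Hd; unfold c, RtoC in *; lra. }
destruct Hcont as (d & Hd & Hk).
(* The radius [e^a] has to be smaller than both [r = e^b] and [d]. *)
set (a := Rmin (b - 1) (ln (d / 2))).
assert (Ha : a < b) by (pose proof (Rmin_l (b - 1) (ln (d / 2))); unfold a; lra).
assert (Had : exp a < d).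
{ apply Rle_lt_trans with (exp (ln (d / 2))).
  - destruct (Rmin_r (b - 1) (ln (d / 2))) as [H|H].
    + left; now apply exp_increasing.
    + right; unfold a; now rewrite H.
  - rewrite exp_ln; lra. }
assert (Hgt : 2 * PI * k < RInt (fun t => Re (g (polar a t))) 0 (2 * PI)).
{ replace (2 * PI * k) with (RInt (fun _ : R => k) 0 (2 * PI)).
  - apply RInt_lt; [lra | intros; apply HU; lra | intros; apply continuous_const |].
    intros t _; apply Hk; now rewrite Cmod_polar.
  - rewrite RInt_const; unfold scal; simpl; unfold mult; simpl; ring. }
rewrite (polar_mean_constant g a b Hg) in Hgt by lra.
fold I in Hgt; lra.
Qed.

(* Apply [Re_le_on_circle] to [conj (g 0) * g], whose value at the centre is [|g 0|^2]. *)
Lemma Cmod_le_on_circle (g : C -> C) (r : R) :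
  (forall w, Cmod w < 1 -> complex_differentiable g w) ->
  0 < r < 1 -> exists w, Cmod w = r /\ Cmod (g (RtoC 0)) <= Cmod (g w).
Proof.
intros Hg Hr.
set (k := g (RtoC 0)).
destruct (Re_le_on_circle (fun w => Cmult (Cconj k) (g w)) r) as (w & Hw & Hle); auto.
- intros w Hw; destruct (Hg w Hw) as [L HL].
  exists (fun h => Cmult (Cconj k) (L h)).
  exact (filterdiff_scal_r_fct (Cconj k) g L Cmult_comm HL).
- exists w; split; [exact Hw|]; fold k in Hle.
  destruct (Rle_lt_dec (Cmod k) 0) as [H0|H0]; [pose proof (Cmod_ge_0 (g w)); lra|].
  apply Rmult_le_reg_l with (Cmod k); [exact H0|].
  pose proof (re_le_Cmod (Cmult (Cconj k) (g w))) as H1.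
  pose proof (Rle_abs (Re (Cmult (Cconj k) (g w)))) as H2.
  rewrite Cmod_mult, Cmod_conj in H1.
  replace (Cmod k * Cmod k) with (Re (Cmult (Cconj k) k)); [lra|].
  pose proof (Cmod2_alt k) as E; simpl in E; rewrite Rmult_1_r in E; rewrite E.
  unfold Re, Im; simpl; ring.
Qed.

(** * Disc automorphisms and the symmetrization map *)

(** Balls of [C] are squares in the real coordinates; the factor [sqrt 2] converts between them and
    discs. *)
Lemma locally_C_Cmod (z : C) (P : C -> Prop) :
  locally z P <-> exists d, 0 < d /\ forall w, Cmod (w - z) < d -> P w.
Proof.
assert (Hs : 0 < sqrt 2) by (apply sqrt_lt_R0; lra).
split.
- intros [e He]; exists e; split; [apply cond_pos|].
  intros w Hw; apply He; exact (C_NormedModule_mixin_compat1 z w e Hw).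
- intros (d & Hd & H).
  assert (He : 0 < d / sqrt 2) by (apply Rdiv_lt_0_compat; lra).
  exists (mkposreal _ He); intros w Hw; apply H.
  pose proof (C_NormedModule_mixin_compat2 z w _ Hw) as Hm; simpl in Hm.
  replace d with (sqrt 2 * (d / sqrt 2)) by (field; lra); exact Hm.
Qed.

Lemma locally_C2_Cmod (x : C2) (P : C2 -> Prop) :
  locally x P <-> exists d, 0 < d /\ forall y : C * C,
    Cmod (fst y - fst x) < d -> Cmod (snd y - snd x) < d -> P y.
Proof.
assert (Hs : 0 < sqrt 2) by (apply sqrt_lt_R0; lra).
split.
- intros [e He]; exists e; split; [apply cond_pos|].
  intros y H1 H2; apply He; split.
  + exact (C_NormedModule_mixin_compat1 _ _ e H1).
  + exact (C_NormedModule_mixin_compat1 _ _ e H2).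
- intros (d & Hd & H).
  assert (He : 0 < d / sqrt 2) by (apply Rdiv_lt_0_compat; lra).
  assert (E : d = sqrt 2 * (d / sqrt 2)) by (field; lra).
  exists (mkposreal _ He); intros y [H1 H2]; apply H.
  + rewrite E; exact (C_NormedModule_mixin_compat2 _ _ _ H1).
  + rewrite E; exact (C_NormedModule_mixin_compat2 _ _ _ H2).
Qed.

Lemma ex_filterdiff_Cplus (U : NormedModule C_AbsRing) (f g : U -> C_NormedModule) (x : U) :
  ex_filterdiff f (locally x) -> ex_filterdiff g (locally x) ->
  @ex_filterdiff C_AbsRing U C_NormedModule (fun t => (f t + g t)%C) (locally x).
Proof.
intros [lf Hf] [lg Hg]; eexists.
exact (filterdiff_plus_fct f g lf lg Hf Hg).
Qed.

(** [C] is packaged in two ways as a normed module over itself. [filterdiff] sees the target only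
    through its algebra and norm, on which both agree; the product rule is stated for the second. *)
Lemma filterdiff_C_AbsRing (U : NormedModule C_AbsRing) (f lf : U -> C)
  (F : (U -> Prop) -> Prop) :
  @filterdiff C_AbsRing U C_NormedModule f F lf <->
  @filterdiff C_AbsRing U (AbsRing_NormedModule C_AbsRing) f F lf.
Proof.
split; intros [[L1 L2 L3] D]; split; try exact D; split; try exact L1; try exact L2; exact L3.
Qed.

Lemma ex_filterdiff_Cmult (U : NormedModule C_AbsRing) (f g : U -> C_NormedModule) (x : U) :
  ex_filterdiff f (locally x) -> ex_filterdiff g (locally x) ->
  @ex_filterdiff C_AbsRing U C_NormedModule (fun t => (f t * g t)%C) (locally x).
Proof.
intros [lf Hf] [lg Hg]; eexists.
apply filterdiff_C_AbsRing in Hf; apply filterdiff_C_AbsRing in Hg.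
apply filterdiff_C_AbsRing; exact (filterdiff_mult_fct f g x lf lg Cmult_comm Hf Hg).
Qed.

Lemma ex_filterdiff_const (U : NormedModule C_AbsRing) (c : C_NormedModule) (x : U) :
  ex_filterdiff (fun _ : U => c) (locally x).
Proof. eexists; apply filterdiff_const. Qed.

(** A remainder quadratic in [w - z] is negligible against it, so [c] is the derivative. Dividing by
    [K + 1] in the proof also covers [K = 0]. *)
Lemma complex_differentiable_quadratic (g : C -> C) (z c : C) (K d : R) :
  0 < d -> 0 <= K ->
  (forall w, Cmod (w - z) < d ->
    Cmod (g w - g z - c * (w - z)) <= K * (Cmod (w - z) * Cmod (w - z))) ->
  complex_differentiable g z.
Proof.
intros Hd HK H.
exists (fun h => Cmult c h); split.
- exact (is_linear_scal_r (V := C_NormedModule) c Cmult_comm).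
- intros x Hx; apply (is_filter_lim_locally_unique (V := C_NormedModule)) in Hx; subst x.
  intros eps; apply locally_C_Cmod.
  exists (Rmin d (eps / (K + 1))); split.
  { apply Rmin_pos; [exact Hd | apply Rdiv_lt_0_compat; [apply cond_pos | lra]]. }
  intros w Hw.
  assert (H1 := Rmin_l d (eps / (K + 1))); assert (H2 := Rmin_r d (eps / (K + 1))).
  change (Cmod (g w - g z - c * (w - z)) <= eps * Cmod (w - z)).
  eapply Rle_trans; [apply H; lra|].
  pose proof (Cmod_ge_0 (w - z)) as H0.
  rewrite <- Rmult_assoc; apply Rmult_le_compat_r; [exact H0|].
  apply Rle_trans with ((K + 1) * (eps / (K + 1))).
  + apply Rmult_le_compat; lra.
  + right; field; lra.
Qed.

(** For [Cmod z < 1], the automorphism of the unit disc that takes 0 to [z]. *)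
Definition moebius (z w : C) : C := ((w + z) / (1 + Cconj z * w))%C.

Lemma moebius_0 (z : C) : moebius z 0 = z.
Proof. unfold moebius; rewrite Cmult_0_r, Cplus_0_l, Cplus_0_r; now field. Qed.

Lemma moebius_denominator (z w : C) :
  Cmod w < 1 -> 1 - Cmod z <= Cmod (1 + Cconj z * w).
Proof.
intros Hw.
pose proof (Cmod_triangle (1 + Cconj z * w) (- (Cconj z * w))) as H.
replace ((1 + Cconj z * w) + - (Cconj z * w))%C with (RtoC 1) in H by ring.
rewrite Cmod_opp, Cmod_mult, Cmod_conj, Cmod_1 in H.
assert (Cmod z * Cmod w <= Cmod z * 1)
  by (apply Rmult_le_compat_l; [apply Cmod_ge_0 | lra]).
lra.
Qed.

Lemma Cmod_pos_neq_0 (z : C) : 0 < Cmod z -> z <> 0.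
Proof. apply Cmod_gt_0. Qed.

Lemma moebius_differentiable (z w : C) :
  Cmod z < 1 -> Cmod w < 1 -> complex_differentiable (moebius z) w.
Proof.
intros Hz Hw.
set (q := fun v => (1 + Cconj z * v)%C).
assert (Hq : forall v, Cmod v < 1 -> 0 < 1 - Cmod z <= Cmod (q v)).
{ intros v Hv; split; [lra | now apply moebius_denominator]. }
assert (Hq0 : forall v, Cmod v < 1 -> q v <> 0).
{ intros v Hv; apply Cmod_pos_neq_0; specialize (Hq v Hv); lra. }
(* The derivative is [k / q(w)^2]. The remainder is computed exactly below, and its denominator is
   at least [m^3] in modulus; the radius [1 - Cmod w] keeps [v] in the disc. *)
set (k := ((1 - Cconj z * z))%C).
set (m := 1 - Cmod z).
apply complex_differentiable_quadratic
  with (c := (k / (q w * q w))%C) (K := Cmod k * Cmod z / (m * m * m)) (d := 1 - Cmod w).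
- lra.
- assert (0 < m * m * m) by (unfold m; repeat apply Rmult_lt_0_compat; lra).
  apply Rdiv_le_0_compat; [|assumption].
  apply Rmult_le_pos; apply Cmod_ge_0.
- intros v Hv.
  assert (Hv1 : Cmod v < 1).
  { pose proof (Cmod_triangle (v - w) w) as H.
    replace (v - w + w)%C with v in H by ring; lra. }
  pose proof (Hq0 v Hv1) as Nv; pose proof (Hq0 w Hw) as Nw.
  replace (moebius z v - moebius z w - k / (q w * q w) * (v - w))%C
    with (- (k * Cconj z) * ((v - w) * (v - w)) / (q w * q w * q v))%C.
  + rewrite Cmod_div by (repeat apply Cmult_neq_0; assumption).
    rewrite !Cmod_mult, Cmod_opp, Cmod_mult, Cmod_conj.
    destruct (Hq v Hv1) as [M Mv]; destruct (Hq w Hw) as [_ Mw]; fold m in M, Mv, Mw.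
    assert (Hinv : / (Cmod (q w) * Cmod (q w) * Cmod (q v)) <= / (m * m * m)).
    { apply Rinv_le_contravar; [repeat apply Rmult_lt_0_compat; assumption|].
      repeat apply Rmult_le_compat; try lra; apply Rmult_le_pos; lra. }
    assert (Hnum : 0 <= Cmod k * Cmod z * (Cmod (v - w) * Cmod (v - w)))
      by (repeat apply Rmult_le_pos; apply Cmod_ge_0).
    pose proof (Rmult_le_compat_l _ _ _ Hnum Hinv).
    unfold Rdiv; lra.
  + unfold moebius, k; fold (q v) (q w); unfold q in *; field; auto.
Qed.

(** The Schwarz-Pick identity with its denominator cleared. It shows both that the disc is preserved
    and that points near the circle stay near it. *)
Lemma moebius_identity (z w : C) :
  Cmod z < 1 -> Cmod w < 1 ->
  (1 - Cmod (moebius z w) * Cmod (moebius z w)) *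
    (Cmod (1 + Cconj z * w) * Cmod (1 + Cconj z * w)) =
  (1 - Cmod w * Cmod w) * (1 - Cmod z * Cmod z).
Proof.
intros Hz Hw.
pose proof (moebius_denominator z w Hw) as HQ.
assert (HQ0 : (1 + Cconj z * w)%C <> 0) by (apply Cmod_pos_neq_0; lra).
unfold moebius; rewrite Cmod_div by exact HQ0.
transitivity (Cmod (1 + Cconj z * w) * Cmod (1 + Cconj z * w)
  - Cmod (w + z) * Cmod (w + z)); [field; lra|].
assert (E : forall c, Cmod c * Cmod c = Re c ^ 2 + Im c ^ 2)
  by (intros c; rewrite <- Cmod2_alt; ring).
rewrite !E; destruct z as [z1 z2]; destruct w as [w1 w2]; unfold Re, Im; simpl; ring.
Qed.

Lemma one_minus_square_pos (t : R) : 0 <= t < 1 -> 0 < 1 - t * t.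
Proof.
intros Ht; replace (1 - t * t) with ((1 - t) * (1 + t)) by ring.
apply Rmult_lt_0_compat; lra.
Qed.

Lemma moebius_disc (z w : C) : Cmod z < 1 -> Cmod w < 1 -> Cmod (moebius z w) < 1.
Proof.
intros Hz Hw.
pose proof (moebius_denominator z w Hw) as HQ.
pose proof (moebius_identity z w Hz Hw) as Hid.
apply Rnot_le_lt; intros Hle.
assert (H1 : 1 * 1 <= Cmod (moebius z w) * Cmod (moebius z w)) by (apply Rmult_le_compat; lra).
pose proof (one_minus_square_pos (Cmod w) (conj (Cmod_ge_0 w) Hw)) as Pw.
pose proof (one_minus_square_pos (Cmod z) (conj (Cmod_ge_0 z) Hz)) as Pz.
pose proof (Rmult_lt_0_compat _ _ Pw Pz) as P; rewrite <- Hid in P.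
set (Q := Cmod (1 + Cconj z * w)) in *.
assert (0 < Q * Q) by (apply Rmult_lt_0_compat; lra).
assert ((1 - Cmod (moebius z w) * Cmod (moebius z w)) * (Q * Q) <= 0 * (Q * Q))
  by (apply Rmult_le_compat_r; lra).
lra.
Qed.

(** In [moebius_identity] the right side tends to 0 at the circle while the denominator stays above
    [1 - Cmod z], so one [rho] serves all directions. *)
Lemma moebius_near_circle (z : C) (eta : R) :
  Cmod z < 1 -> 0 <= eta < 1 ->
  exists rho, 0 < rho < 1 /\ forall w, rho <= Cmod w < 1 -> eta < Cmod (moebius z w).
Proof.
intros Hz Heta.
pose proof (Cmod_ge_0 z) as Hz0.
set (m := 1 - Cmod z).
assert (Hm : 0 < m <= 1) by (unfold m; lra).
assert (Hmm : 0 < m * m <= 1).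
{ split; [apply Rmult_lt_0_compat; lra|]. rewrite <- (Rmult_1_r 1); apply Rmult_le_compat; lra. }
assert (He : 0 < (1 - eta) * (m * m) <= 1).
{ split; [apply Rmult_lt_0_compat; lra|]. rewrite <- (Rmult_1_r 1); apply Rmult_le_compat; lra. }
(* This makes [1 - r^2] at most half of [(1 - eta) m^2], and the identity then gives
   [1 - M^2 < 1 - eta], that is, [M^2 > eta >= eta^2]. *)
exists (1 - (1 - eta) * (m * m) / 4); split; [lra|].
intros w [Hw1 Hw2].
pose proof (moebius_identity z w Hz Hw2) as Hid.
pose proof (moebius_denominator z w Hw2) as HQ.
pose proof (Cmod_ge_0 (moebius z w)) as HM.
pose proof (Cmod_ge_0 w) as Hw0.
pose proof (one_minus_square_pos _ (conj Hw0 Hw2)) as Pw.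
set (Q := Cmod (1 + Cconj z * w)) in *; set (M := Cmod (moebius z w)) in *.
set (r := Cmod w) in *; set (t := Cmod z) in *; fold m in HQ.
assert (Hrr : 1 - r * r <= (1 - eta) * (m * m) / 2).
{ replace (1 - r * r) with ((1 - r) * (1 + r)) by ring.
  apply Rle_trans with ((1 - eta) * (m * m) / 4 * 2); [apply Rmult_le_compat; lra | lra]. }
assert (Htt : 0 <= 1 - t * t <= 1).
{ split; [left; now apply one_minus_square_pos|].
  pose proof (Rmult_le_pos t t Hz0 Hz0); lra. }
assert (HQQ : m * m <= Q * Q) by (apply Rmult_le_compat; lra).
assert (Hup : 1 - M * M < 1 - eta).
{ apply Rmult_lt_reg_r with (Q * Q); [lra|]; rewrite Hid.
  apply Rle_lt_trans with ((1 - eta) * (m * m) / 2 * 1); [apply Rmult_le_compat; lra|].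
  apply Rlt_le_trans with ((1 - eta) * (m * m)); [lra|].
  apply Rmult_le_compat_l; lra. }
apply Rnot_le_lt; intros Hle.
assert (M * M <= eta * eta) by (apply Rmult_le_compat; lra).
assert (eta * eta <= eta * 1) by (apply Rmult_le_compat_l; lra).
lra.
Qed.

(** * The symmetrization map and interior points of Gamma *)

Definition symmetrization (z1 z2 : C) : C2 := (z1 + z2, z1 * z2)%C.

(** Half-angle formulas: up to sign the parts are [sqrt ((m + a) / 2)] and [sqrt ((m - a) / 2)]; the
    sign of [b] decides that of the second. *)
Lemma complex_sqrt (z : C) : exists w : C, (w * w = z)%C.
Proof.
destruct z as [a b].
set (m := Cmod (a, b)).
assert (Hm : m * m = a * a + b * b).
{ replace (m * m) with (Cmod (a, b) ^ 2) by (unfold m; ring).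
  rewrite Cmod2_alt; unfold Re, Im; simpl; ring. }
pose proof (Cmod_ge_0 (a, b)) as Hm0; fold m in Hm0.
pose proof (Rmax_Cmod (a, b)) as Hab; apply Rmax_le_both in Hab; simpl in Hab; fold m in Hab.
destruct Hab as [Ha _]; apply Rabs_le_between in Ha.
set (u := sqrt ((m + a) / 2)); set (v := sqrt ((m - a) / 2)).
assert (Hu : u * u = (m + a) / 2) by (apply sqrt_sqrt; lra).
assert (Hv : v * v = (m - a) / 2) by (apply sqrt_sqrt; lra).
assert (Huv : u * v = Rabs b / 2).
{ unfold u, v; rewrite <- sqrt_mult by lra.
  replace ((m + a) / 2 * ((m - a) / 2)) with (Rsqr (b / 2)) by (unfold Rsqr; lra).
  rewrite sqrt_Rsqr_abs; unfold Rdiv; rewrite Rabs_mult, (Rabs_pos_eq (/ 2)); lra. }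
destruct (Rle_lt_dec 0 b) as [Hb|Hb].
- exists (u, v); unfold Cmult; simpl; rewrite (Rabs_pos_eq b Hb) in Huv.
  f_equal; lra.
- exists (u, - v); unfold Cmult; simpl; rewrite (Rabs_left b Hb) in Huv.
  f_equal; lra.
Qed.

Lemma quadratic_roots (s p : C) : exists z1 z2, (s = z1 + z2)%C /\ (p = z1 * z2)%C.
Proof.
destruct (complex_sqrt (s * s - 4 * p)) as [w Hw].
assert (H2 : RtoC 2 <> 0) by (intros E; apply RtoC_inj in E; lra).
assert (H4 : RtoC 4 <> 0) by (intros E; apply RtoC_inj in E; lra).
exists ((s + w) / 2)%C, ((s - w) / 2)%C; split; [now field|].
transitivity ((s * s - (s * s - 4 * p)) / 4)%C; [now field|].
rewrite <- Hw; now field.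
Qed.

Lemma symmetrization_surjective (x : C2) : exists z1 z2, x = symmetrization z1 z2.
Proof.
destruct x as [s p]; destruct (quadratic_roots s p) as (z1 & z2 & -> & ->).
now exists z1, z2.
Qed.

(** If [|w| >= 1], then [|w - a| |w - b|] is at least [(1 - rho)^2 |w|^2], but the equation for [w]
    makes it less than [2 delta |w|]. This gives stability of the roots without labelling them. *)
Lemma quadratic_root_in_disc (a b s p w : C) (rho delta : R) :
  Cmod a <= rho -> Cmod b <= rho -> rho < 1 ->
  (w * w - s * w + p = 0)%C ->
  Cmod (s - (a + b)) < delta -> Cmod (p - a * b) < delta ->
  delta <= (1 - rho) * (1 - rho) / 2 -> Cmod w < 1.
Proof.
intros Ha Hb Hrho Hw Hs Hp Hdelta.
apply Rnot_le_lt; intros H1.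
assert (E : ((w - a) * (w - b) = (s - (a + b)) * w - (p - a * b))%C).
{ transitivity ((w * w - s * w + p) + ((s - (a + b)) * w - (p - a * b)))%C; [ring|].
  rewrite Hw; ring. }
apply (f_equal Cmod) in E; rewrite Cmod_mult in E.
assert (Hup : Cmod ((s - (a + b)) * w - (p - a * b)) < delta * (2 * Cmod w)).
{ eapply Rle_lt_trans; [apply Cmod_triangle|].
  rewrite Cmod_opp, Cmod_mult.
  pose proof (Cmod_ge_0 (s - (a + b))) as G1.
  assert (Cmod (s - (a + b)) * Cmod w <= delta * Cmod w) by (apply Rmult_le_compat_r; lra).
  assert (delta * 1 <= delta * Cmod w) by (apply Rmult_le_compat_l; lra).
  lra. }
assert (Hlow : forall c, Cmod c <= rho -> (1 - rho) * Cmod w <= Cmod (w - c)).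
{ intros c Hc; pose proof (Cmod_triangle (w - c) c) as G.
  replace (w - c + c)%C with w in G by ring.
  assert (0 <= rho) by (pose proof (Cmod_ge_0 c); lra).
  assert (rho * 1 <= rho * Cmod w) by (apply Rmult_le_compat_l; lra).
  lra. }
assert (Hprod : (1 - rho) * Cmod w * ((1 - rho) * Cmod w) <= Cmod (w - a) * Cmod (w - b)).
{ apply Rmult_le_compat; auto; apply Rmult_le_pos; lra. }
assert (G : delta * (2 * Cmod w) <= (1 - rho) * (1 - rho) / 2 * (2 * Cmod w))
  by (apply Rmult_le_compat_r; lra).
assert (G2 : (1 - rho) * (1 - rho) * Cmod w * 1 <= (1 - rho) * (1 - rho) * Cmod w * Cmod w).
{ apply Rmult_le_compat_l; [|exact H1]; repeat apply Rmult_le_pos; lra. }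
lra.
Qed.

Lemma symmetrized_bidisc_interior (a b : C) :
  Cmod a < 1 -> Cmod b < 1 -> locally (symmetrization a b) symmetrized_bidisc.
Proof.
intros Ha Hb.
set (rho := Rmax (Cmod a) (Cmod b)).
assert (Hrho : rho < 1) by (unfold rho; apply Rmax_lub_lt; assumption).
apply locally_C2_Cmod; exists ((1 - rho) * (1 - rho) / 2); split.
{ assert (0 < (1 - rho) * (1 - rho)) by (apply Rmult_lt_0_compat; lra); lra. }
intros y H1 H2; destruct (symmetrization_surjective y) as (z1 & z2 & ->).
simpl in H1, H2.
exists z1, z2; repeat split; left;
  apply (quadratic_root_in_disc a b (z1 + z2) (z1 * z2) _ rho ((1 - rho) * (1 - rho) / 2));
  try assumption; try apply Rmax_l; try apply Rmax_r; try lra; ring.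
Qed.

(** The two automorphisms give an analytic disc in Gamma centred at [symmetrization a b]; apply
    [Cmod_le_on_circle] to [f] along it, on a circle of radius large enough for both. *)
Lemma bidisc_push_to_torus (f : C2 -> C_NormedModule) (a b : C) (eta : R) :
  holomorphic_in_interior symmetrized_bidisc f ->
  Cmod a < 1 -> Cmod b < 1 -> 0 <= eta < 1 ->
  exists z1 z2, eta < Cmod z1 < 1 /\ eta < Cmod z2 < 1 /\
    Cmod (f (symmetrization a b)) <= Cmod (f (symmetrization z1 z2)).
Proof.
intros Hf Ha Hb Heta.
destruct (moebius_near_circle a eta Ha Heta) as (r1 & Hr1 & H1).
destruct (moebius_near_circle b eta Hb Heta) as (r2 & Hr2 & H2).
destruct (Cmod_le_on_circle (fun w => f (symmetrization (moebius a w) (moebius b w)))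
  (Rmax r1 r2)) as (w & Hw & Hle).
- intros w Hw.
  destruct (moebius_differentiable a w Ha Hw) as [l1 D1].
  destruct (moebius_differentiable b w Hb Hw) as [l2 D2].
  destruct (ex_filterdiff_Cplus C_NormedModule (moebius a) (moebius b) w)
    as [ls Ds]; [now exists l1 | now exists l2 |].
  destruct (ex_filterdiff_Cmult C_NormedModule (moebius a) (moebius b) w)
    as [lp Dp]; [now exists l1 | now exists l2 |].
  destruct (Hf (symmetrization (moebius a w) (moebius b w))) as [l D].
  + now apply symmetrized_bidisc_interior; apply moebius_disc.
  + exists (fun h => l (ls h, lp h)).
    apply (filterdiff_comp'_2 (T := C_NormedModule) (U := C_NormedModule) (V := C_NormedModule)
      _ _ (fun s p => f (s, p)) w ls lp (fun s p => l (s, p)) Ds Dp).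
    apply filterdiff_ext with (f := f); [now intros [s p]|].
    apply filterdiff_ext_lin with (l1 := l); [exact D | now intros [s p]].
- pose proof (Rmax_l r1 r2); split; [lra | apply Rmax_lub_lt; lra].
- assert (Hw1 : Cmod w < 1) by (rewrite Hw; apply Rmax_lub_lt; lra).
  pose proof (Rmax_l r1 r2); pose proof (Rmax_r r1 r2).
  exists (moebius a w), (moebius b w); repeat split.
  + apply H1; lra.
  + now apply moebius_disc.
  + apply H2; lra.
  + now apply moebius_disc.
  + rewrite !moebius_0 in Hle; exact Hle.
Qed.

(** * The image of the torus *)

Lemma Cmod_square (z : C) : Cmod z * Cmod z = Re z * Re z + Im z * Im z.
Proof. pose proof (Cmod2_alt z) as H; simpl in H; lra. Qed.

Lemma Cconj_mult_self (z : C) : (Cconj z * z)%C = RtoC (Cmod z * Cmod z).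
Proof.
rewrite Cmod_square; destruct z as [a b].
unfold Cmult, Cconj, RtoC, Re, Im; simpl; f_equal; ring.
Qed.

Lemma Cmod_1_conj (z : C) : Cmod z = 1 -> (Cconj z * z)%C = RtoC 1.
Proof. intros H; rewrite Cconj_mult_self, H; f_equal; ring. Qed.

Definition torus_image (x : C2) : Prop :=
  exists z1 z2, Cmod z1 = 1 /\ Cmod z2 = 1 /\ x = symmetrization z1 z2.

(** For the converse, write [p = w^2]. The equation makes [Cconj s * w] a real number [t], so
    [s = t w] with [|t| <= 2]. Then [t] is the sum of the conjugate unit numbers [t/2 + iv] and
    [t/2 - iv], and multiplying these by [w] gives the two points. *)
Lemma torus_image_iff (s p : C) :
  torus_image (s, p) <-> Cmod p = 1 /\ s = (Cconj s * p)%C /\ Cmod s <= 2.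
Proof.
split.
- intros (z1 & z2 & H1 & H2 & E); injection E as Es Ep.
  assert (Hp : Cmod p = 1) by (rewrite Ep, Cmod_mult, H1, H2; ring).
  split; [exact Hp|split].
  + rewrite Es at 2; rewrite Cplus_conj, Ep.
    transitivity (Cconj z1 * z1 * z2 + Cconj z2 * z2 * z1)%C; [|ring].
    rewrite (Cmod_1_conj z1 H1), (Cmod_1_conj z2 H2), Es; ring.
  + rewrite Es; eapply Rle_trans; [apply Cmod_triangle|]; lra.
- intros (Hp & Hs & Hle).
  destruct (complex_sqrt p) as [w Hw].
  assert (Hw1 : Cmod w = 1).
  { assert (E : Cmod w * Cmod w = 1) by (rewrite <- Cmod_mult, Hw; exact Hp).
    pose proof (Cmod_ge_0 w); nra. }
  set (t := Re (Cconj s * w)).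
  assert (Hreal : (Cconj s * w)%C = RtoC t).
  { assert (E : (Cconj s * w = Cconj (Cconj s * w))%C).
    { rewrite Cmult_conj, Cconj_conj.
      transitivity (Cconj s * (w * w) * Cconj w)%C; [|now rewrite Hw, <- Hs].
      transitivity (Cconj s * w * (Cconj w * w))%C; [|ring].
      rewrite (Cmod_1_conj w Hw1); ring. }
    unfold t; destruct (Cconj s * w)%C as [a b]; injection E as E; unfold RtoC, Re; simpl.
    f_equal; lra. }
  assert (Hst : s = (t * w)%C).
  { rewrite Hs, <- Hw, Cmult_assoc, Hreal; reflexivity. }
  assert (Ht : t * t <= 4).
  { assert (E : Cmod s = Rabs t) by (rewrite Hst, Cmod_mult, Hw1, Cmod_R; ring).
    rewrite E in Hle; apply Rabs_le_between in Hle; nra. }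
  set (v := sqrt (1 - t * t / 4)).
  assert (Hv : v * v = 1 - t * t / 4) by (apply sqrt_sqrt; lra).
  assert (Hunit : forall a b : R, a * a + b * b = 1 -> Cmod (a, b) = 1).
  { intros a b Hab; pose proof (Cmod_square (a, b)) as E; unfold Re, Im in E; simpl in E.
    pose proof (Cmod_ge_0 (a, b)); nra. }
  exists (w * (t / 2, v)%R)%C, (w * (t / 2, - v)%R)%C; repeat split.
  + rewrite Cmod_mult, Hw1, Hunit; lra.
  + rewrite Cmod_mult, Hw1, Hunit; lra.
  + unfold symmetrization; f_equal.
    * rewrite Hst, <- Cmult_plus_distr_l, Cmult_comm; f_equal.
      unfold RtoC, Cplus; simpl; f_equal; field.
    * transitivity (w * w * ((t / 2, v)%R * (t / 2, - v)%R))%C; [|ring].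
      rewrite Hw; rewrite <- (Cmult_1_r p) at 1; f_equal.
      unfold Cmult, RtoC; simpl; f_equal; lra.
Qed.

Lemma torus_image_equations (s p : C) :
  torus_image (s, p) <->
  s = (Cconj s * p)%C /\ (Cmod (s ^ 2 - 4 * p)%C + Cmod s ^ 2 = 4)%R.
Proof.
rewrite torus_image_iff.
(* The first equation gives [s^2 = |s|^2 p], so [s^2 - 4p] equals [(|s|^2 - 4) p]. *)
assert (Hdisc : s = (Cconj s * p)%C ->
  Cmod (s ^ 2 - 4 * p) = Rabs (Cmod s ^ 2 - 4) * Cmod p).
{ intros Hs; rewrite <- Cmod_R, <- Cmod_mult; f_equal.
  replace (s ^ 2)%C with (s * s)%C by (simpl; ring).
  rewrite Hs at 2.
  transitivity ((Cconj s * s - 4) * p)%C; [ring|].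
  rewrite Cconj_mult_self, RtoC_minus; do 3 f_equal; ring. }
pose proof (Cmod_ge_0 s) as Hs0.
split.
- intros (Hp & Hs & Hle); split; [exact Hs|].
  rewrite Hdisc, Hp by exact Hs; rewrite Rabs_left1; nra.
- intros [Hs HD]; rewrite Hdisc in HD by exact Hs.
  assert (Hmod : Cmod s = Cmod s * Cmod p) by (rewrite Hs at 1; now rewrite Cmod_mult, Cmod_conj).
  (* When [s = 0] the second equation reads [4 |p| = 4]; otherwise [|s|] is cancelled in [Hmod]. *)
  assert (Hp : Cmod p = 1).
  { destruct (Req_dec (Cmod s) 0) as [E|E].
    - rewrite E in HD; rewrite Rabs_left1 in HD by lra; lra.
    - apply Rmult_eq_reg_l with (Cmod s); lra. }
  repeat split; auto.
  rewrite Hp in HD; apply Rnot_lt_le; intros Hlt.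
  rewrite Rabs_pos_eq in HD by nra; nra.
Qed.

Lemma torus_image_closed : closed torus_image.
Proof.
(* In real coordinates the conditions are [|p| = 1], the two parts of [s = Cconj s * p], and
   [|s| <= 2]: closed conditions on real polynomials. *)
apply closed_ext with (D := fun x : C2 =>
  let a := fst (fst x) in let b := snd (fst x) in
  let c := fst (snd x) in let d := snd (snd x) in
  (c * c + d * d = 1 /\ a - (a * c + b * d) = 0) /\
  (b - (a * d - b * c) = 0 /\ a * a + b * b <= 4)).
{ intros [[a b] [c d]]; rewrite torus_image_iff; cbv zeta; simpl fst; simpl snd.
  pose proof (Cmod_square (a, b)) as E1; pose proof (Cmod_square (c, d)) as E2.
  pose proof (Cmod_ge_0 (a, b)) as G1; pose proof (Cmod_ge_0 (c, d)) as G2.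
  unfold Re, Im in E1, E2; simpl in E1, E2.
  split.
  - intros [[H1 H2] [H3 H4]]; repeat split.
    + nra.
    + unfold Cmult, Cconj; simpl; f_equal; lra.
    + nra.
  - intros (H1 & H2 & H3); unfold Cmult, Cconj in H2; simpl in H2; injection H2 as H4 H5.
    repeat split; nra. }
assert (Ha : forall x : C2, continuous (fun x : C2 => fst (fst x)) x).
{ intros [[a b] [c d]]; apply (continuous_comp (fst : C2 -> C_UniformSpace) fst);
  apply continuous_fst. }
assert (Hb : forall x : C2, continuous (fun x : C2 => snd (fst x)) x).
{ intros [[a b] [c d]]; apply (continuous_comp (fst : C2 -> C_UniformSpace) snd);
  [apply continuous_fst | apply continuous_snd]. }
assert (Hc : forall x : C2, continuous (fun x : C2 => fst (snd x)) x).
{ intros [[a b] [c d]]; apply (continuous_comp (snd : C2 -> C_UniformSpace) fst);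
  [apply continuous_snd | apply continuous_fst]. }
assert (Hd : forall x : C2, continuous (fun x : C2 => snd (snd x)) x).
{ intros [[a b] [c d]]; apply (continuous_comp (snd : C2 -> C_UniformSpace) snd);
  apply continuous_snd. }
assert (plus_c : forall (f g : C2 -> R), (forall x, continuous f x) ->
  (forall x, continuous g x) -> forall x, continuous (fun x => f x + g x) x).
{ intros f g Hf Hg x; exact (continuous_plus f g x (Hf x) (Hg x)). }
assert (minus_c : forall (f g : C2 -> R), (forall x, continuous f x) ->
  (forall x, continuous g x) -> forall x, continuous (fun x => f x - g x) x).
{ intros f g Hf Hg x; exact (continuous_minus f g x (Hf x) (Hg x)). }
assert (mult_c : forall (f g : C2 -> R), (forall x, continuous f x) ->
  (forall x, continuous g x) -> forall x, continuous (fun x => f x * g x) x).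
{ intros f g Hf Hg x; exact (continuous_mult f g x (Hf x) (Hg x)). }
assert (closed_preimage : forall (f : C2 -> R) (D : R -> Prop),
  (forall x, continuous f x) -> closed D -> closed (fun x : C2 => D (f x))).
{ intros f D Hf; exact (closed_comp f D Hf). }
cbv zeta; repeat apply closed_and.
- apply (closed_preimage (fun x : C2 =>
    fst (snd x) * fst (snd x) + snd (snd x) * snd (snd x)) (fun r => r = 1));
  [auto 10 | apply closed_eq].
- apply (closed_preimage (fun x : C2 => fst (fst x) -
    (fst (fst x) * fst (snd x) + snd (fst x) * snd (snd x))) (fun r => r = 0));
  [auto 10 | apply closed_eq].
- apply (closed_preimage (fun x : C2 => snd (fst x) -
    (fst (fst x) * snd (snd x) - snd (fst x) * fst (snd x))) (fun r => r = 0));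
  [auto 10 | apply closed_eq].
- apply (closed_preimage (fun x : C2 =>
    fst (fst x) * fst (fst x) + snd (fst x) * snd (fst x)) (fun r => r <= 4));
  [auto 10 | apply closed_le].
Qed.

(** * The image of the torus is a boundary *)

Lemma Cmod_polar_0 (t : R) : Cmod (polar 0 t) = 1.
Proof. rewrite Cmod_polar; apply exp_0. Qed.

(** The angle is [acos] of the normalised real part, with the sign of the imaginary part. Its closed
    range lets [rectangle_induction] cover the torus. *)
Lemma polar_form (z : C) : z <> 0 ->
  exists t, - PI <= t <= PI /\ z = (Cmod z * polar 0 t)%C.
Proof.
intros Hz; apply Cmod_gt_0 in Hz; pose proof (Cmod_square z) as Hsq.
set (r := Cmod z) in *.
destruct z as [a b]; unfold Re, Im in Hsq; simpl in Hsq.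
set (c := a / r); set (d := b / r).
assert (Ha : a = r * c) by (unfold c; field; lra).
assert (Hb : b = r * d) by (unfold d; field; lra).
assert (Hcd : c * c + d * d = 1).
{ unfold c, d; apply Rmult_eq_reg_l with (r * r); [|nra].
  transitivity (a * a + b * b); [field; lra | lra]. }
assert (Hc : -1 <= c <= 1) by nra.
pose proof (acos_bound c) as Hac.
assert (Hsin : sin (acos c) = Rabs d).
{ rewrite sin_acos by exact Hc; rewrite <- sqrt_Rsqr_abs; f_equal; unfold Rsqr; lra. }
assert (Hgoal : forall t, cos t = c -> sin t = d -> (a, b) = (r * polar 0 t)%C).
{ intros t H1 H2; unfold polar; rewrite exp_0, H1, H2, Ha, Hb.
  unfold Cmult, RtoC; simpl; f_equal; ring. }
destruct (Rle_lt_dec 0 d) as [Hd|Hd].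
- exists (acos c); split; [lra|]; apply Hgoal; [now apply cos_acos|].
  now rewrite Hsin, Rabs_pos_eq.
- exists (- acos c); split; [lra|]; apply Hgoal.
  + rewrite cos_neg; now apply cos_acos.
  + rewrite sin_neg, Hsin, Rabs_left by exact Hd; ring.
Qed.

Lemma polar_continuous (u eps : R) : 0 < eps ->
  exists delta, 0 < delta /\ forall t, Rabs (t - u) < delta ->
    Cmod (polar 0 t - polar 0 u) < eps.
Proof.
intros Heps.
assert (He : 0 < eps / 2) by lra.
pose proof (proj1 (filterlim_locally _ _) (continuous_cos u) (mkposreal _ He)) as [d1 H1].
pose proof (proj1 (filterlim_locally _ _) (continuous_sin u) (mkposreal _ He)) as [d2 H2].
exists (Rmin d1 d2); split; [apply Rmin_pos; apply cond_pos|].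
intros t Ht.
pose proof (Rmin_l d1 d2); pose proof (Rmin_r d1 d2).
specialize (H1 t ltac:(change (Rabs (t - u) < d1); lra)).
specialize (H2 t ltac:(change (Rabs (t - u) < d2); lra)).
change (Rabs (cos t - cos u) < eps / 2) in H1.
change (Rabs (sin t - sin u) < eps / 2) in H2.
apply Rabs_lt_between in H1; apply Rabs_lt_between in H2.
pose proof (Cmod_square (polar 0 t - polar 0 u)) as E.
unfold polar, Re, Im in E; simpl in E; rewrite exp_0 in E.
apply Rnot_le_lt; intros Hle.
unfold polar in Hle; rewrite exp_0 in Hle; nra.
Qed.

Lemma symmetrization_continuous_on (f : C2 -> C_NormedModule) (a b : C) (eps : R) :
  continuous_on symmetrized_bidisc f -> Cmod a <= 1 -> Cmod b <= 1 -> 0 < eps ->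
  exists delta, 0 < delta /\ forall z1 z2, Cmod z1 <= 1 -> Cmod z2 <= 1 ->
    Cmod (z1 - a) < delta -> Cmod (z2 - b) < delta ->
    Cmod (f (symmetrization z1 z2) - f (symmetrization a b)) < eps.
Proof.
intros Hf Ha Hb Heps.
assert (Hin : symmetrized_bidisc (symmetrization a b)) by (exists a, b; auto).
assert (Hnear : locally (f (symmetrization a b))
  (fun y => Cmod (y - f (symmetrization a b)) < eps)).
{ apply locally_C_Cmod; exists eps; auto. }
specialize (Hf _ Hin _ Hnear).
apply locally_C2_Cmod in Hf; destruct Hf as (d & Hd & Hf).
exists (d / 2); split; [lra|]; intros z1 z2 H1 H2 K1 K2.
apply (Hf (symmetrization z1 z2)).
- simpl; replace (z1 + z2 - (a + b))%C with ((z1 - a) + (z2 - b))%C by ring.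
  eapply Rle_lt_trans; [apply Cmod_triangle|]; lra.
- simpl; replace (z1 * z2 - a * b)%C with (z1 * (z2 - b) + b * (z1 - a))%C by ring.
  eapply Rle_lt_trans; [apply Cmod_triangle|]; rewrite !Cmod_mult.
  pose proof (Cmod_ge_0 (z1 - a)); pose proof (Cmod_ge_0 (z2 - b)).
  assert (Cmod z1 * Cmod (z2 - b) <= 1 * Cmod (z2 - b)) by (apply Rmult_le_compat_r; lra).
  assert (Cmod b * Cmod (z1 - a) <= 1 * Cmod (z1 - a)) by (apply Rmult_le_compat_r; lra).
  lra.
- exists z1, z2; auto.
Qed.

Lemma Cmod_sub_lt (x y : C) (e : R) : Cmod (x - y) < e -> Cmod x < Cmod y + e /\ Cmod y < Cmod x + e.
Proof.
intros H; split.
- pose proof (Cmod_triangle (x - y) y) as T.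
  replace (x - y + y)%C with x in T by ring; lra.
- pose proof (Cmod_triangle (- (x - y)) x) as T; rewrite Cmod_opp in T.
  replace (- (x - y) + x)%C with y in T by ring; lra.
Qed.

(** A slight radial contraction of both coordinates enters the open bidisc, and continuity keeps the
    value above [M]. *)
Lemma shrink_to_open_bidisc (f : C2 -> C_NormedModule) (a b : C) (M : R) :
  continuous_on symmetrized_bidisc f -> Cmod a <= 1 -> Cmod b <= 1 ->
  M < Cmod (f (symmetrization a b)) ->
  exists z1 z2, Cmod z1 < 1 /\ Cmod z2 < 1 /\ M < Cmod (f (symmetrization z1 z2)).
Proof.
intros Hf Ha Hb HM.
destruct (symmetrization_continuous_on f a b (Cmod (f (symmetrization a b)) - M))
  as (d & Hd & H); try assumption; [lra|].
set (e := Rmin (d / 2) (1 / 2)).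
assert (He : 0 < e <= 1 / 2)
  by (unfold e; split; [apply Rmin_pos; lra | apply Rmin_r]).
assert (Hed : e < d) by (pose proof (Rmin_l (d / 2) (1 / 2)); unfold e; lra).
assert (Hlt : forall c, Cmod c <= 1 ->
  Cmod (RtoC (1 - e) * c) < 1 /\ Cmod (RtoC (1 - e) * c - c) < d).
{ intros c Hc; pose proof (Cmod_ge_0 c); split.
  - rewrite Cmod_mult, Cmod_R, Rabs_pos_eq by lra; nra.
  - replace (RtoC (1 - e) * c - c)%C with (- (RtoC e * c))%C
      by (rewrite RtoC_minus; ring).
    rewrite Cmod_opp, Cmod_mult, Cmod_R, Rabs_pos_eq by lra; nra. }
destruct (Hlt a Ha) as [A1 A2]; destruct (Hlt b Hb) as [B1 B2].
exists (RtoC (1 - e) * a)%C, (RtoC (1 - e) * b)%C; repeat split; try assumption.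
pose proof (Cmod_sub_lt _ _ _ (H _ _ (Rlt_le _ _ A1) (Rlt_le _ _ B1) A2 B2)); lra.
Qed.

(* If no point of the torus is a maximum point, then by compactness of the torus a
   single interior value strictly dominates |f| near the whole torus; this contradicts
   [bidisc_push_to_torus]. *)
Lemma torus_image_maximum (f : C2 -> C_NormedModule) :
  holomorphic_algebra symmetrized_bidisc f ->
  exists x, torus_image x /\ forall y, symmetrized_bidisc y -> Cmod (f y) <= Cmod (f x).
Proof.
intros [Hc Hh]; apply NNPP; intros Hno.
(* [P] says that one value inside the bidisc strictly dominates [|f|] on the part of the closed
   bidisc within [d] of a product of arcs. *)
set (P := fun t1 t2 u1 u2 => exists a b d, Cmod a < 1 /\ Cmod b < 1 /\ 0 < d /\
  forall t u z1 z2, t1 <= t <= t2 -> u1 <= u <= u2 -> Cmod z1 <= 1 -> Cmod z2 <= 1 ->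
    Cmod (z1 - polar 0 t) < d -> Cmod (z2 - polar 0 u) < d ->
    Cmod (f (symmetrization z1 z2)) < Cmod (f (symmetrization a b))).
assert (Hpi := PI_RGT_0).
(* Of two dominating points keep the one with the larger value, together with the smaller [d]. *)
assert (Hmerge : forall t1 t2 u1 u2 t1' t2' u1' u2' t1'' t2'' u1'' u2'',
  (forall t u, t1 <= t <= t2 -> u1 <= u <= u2 ->
    (t1' <= t <= t2' /\ u1' <= u <= u2') \/ (t1'' <= t <= t2'' /\ u1'' <= u <= u2'')) ->
  P t1' t2' u1' u2' -> P t1'' t2'' u1'' u2'' -> P t1 t2 u1 u2).
{ intros t1 t2 u1 u2 t1' t2' u1' u2' t1'' t2'' u1'' u2'' Hcover
    (a & b & d & Ha & Hb & Hd & H) (a' & b' & d' & Ha' & Hb' & Hd' & H').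
  pose proof (Rmin_l d d'); pose proof (Rmin_r d d').
  destruct (Rle_lt_dec (Cmod (f (symmetrization a b))) (Cmod (f (symmetrization a' b'))))
    as [Hle|Hle];
  [exists a', b', (Rmin d d') | exists a, b, (Rmin d d')];
  (repeat split; try assumption; [now apply Rmin_pos|]);
  intros t u z1 z2 Ht Hu Z1 Z2 K1 K2;
  (destruct (Hcover t u Ht Hu) as [[T U]|[T U]];
  [specialize (H t u z1 z2 T U Z1 Z2) | specialize (H' t u z1 z2 T U Z1 Z2)]); lra. }
assert (HP : P (- PI) PI (- PI) PI).
{ apply rectangle_induction; try lra.
  - intros t1 m t2 u1 u2 _ _ _ _; apply Hmerge.
    intros t u Ht Hu; destruct (Rle_lt_dec t m); [left | right]; lra.
  - intros t1 t2 u1 m u2 _ _ _ _; apply Hmerge.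
    intros t u Ht Hu; destruct (Rle_lt_dec u m); [left | right]; lra.
  - intros u v _ _.
    set (x := symmetrization (polar 0 u) (polar 0 v)).
    assert (Hex : exists y, symmetrized_bidisc y /\ Cmod (f x) < Cmod (f y)).
    { apply NNPP; intros Hn; apply Hno; exists x; split.
      - exists (polar 0 u), (polar 0 v); repeat split; apply Cmod_polar_0.
      - intros y Hy; apply Rnot_lt_le; intros Hlt; apply Hn; now exists y. }
    destruct Hex as (y & (w1 & w2 & W1 & W2 & ->) & Hlt).
    destruct (shrink_to_open_bidisc f w1 w2 _ Hc W1 W2 Hlt) as (a & b & Ha & Hb & Hab).
    pose proof (Cmod_polar_0 u) as Pu; pose proof (Cmod_polar_0 v) as Pv.
    destruct (symmetrization_continuous_on f (polar 0 u) (polar 0 v)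
      (Cmod (f (symmetrization a b)) - Cmod (f x))) as (d & Hd & Hnear); try lra; [exact Hc|].
    destruct (polar_continuous u (d / 2)) as (d1 & Hd1 & H1); [lra|].
    destruct (polar_continuous v (d / 2)) as (d2 & Hd2 & H2); [lra|].
    exists (Rmin d1 d2); split; [now apply Rmin_pos|].
    intros t1 t2 u1 u2 Ht1 Ht2 Hu1 Hu2 Ht Hu _.
    pose proof (Rmin_l d1 d2); pose proof (Rmin_r d1 d2).
    exists a, b, (d / 2); repeat split; try assumption; [lra|].
    intros t s z1 z2 T S Z1 Z2 K1 K2.
    assert (Hsum : forall z p q, Cmod (z - p) < d / 2 -> Cmod (p - q) < d / 2 ->
      Cmod (z - q) < d).
    { intros z p q L1 L2; replace (z - q)%C with ((z - p) + (p - q))%C by ring.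
      eapply Rle_lt_trans; [apply Cmod_triangle|]; lra. }
    assert (L := Cmod_sub_lt _ _ _ (Hnear z1 z2 Z1 Z2
      (Hsum _ _ _ K1 (H1 t ltac:(apply Rabs_lt_between; lra)))
      (Hsum _ _ _ K2 (H2 s ltac:(apply Rabs_lt_between; lra))))).
    fold x in L; lra. }
destruct HP as (a & b & d & Ha & Hb & Hd & H).
(* A point of modulus between [eta] and 1 is within [d] of its radial projection to the circle;
   [eta >= 0] keeps it away from 0, so that this projection exists. *)
set (eta := Rmax 0 (1 - d)).
assert (Heta : 0 <= eta < 1) by (unfold eta; split; [apply Rmax_l | apply Rmax_lub_lt; lra]).
assert (Hetad : 1 - eta <= d) by (pose proof (Rmax_r 0 (1 - d)); unfold eta; lra).
destruct (bidisc_push_to_torus f a b eta Hh Ha Hb Heta) as (z1 & z2 & Z1 & Z2 & Hle).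
assert (Hpol : forall z, eta < Cmod z < 1 ->
  exists t, - PI <= t <= PI /\ Cmod (z - polar 0 t) < d).
{ intros z Hz; destruct (polar_form z) as (t & Ht & E).
  - apply Cmod_gt_0; lra.
  - exists t; split; [exact Ht|].
    replace (z - polar 0 t)%C with (RtoC (Cmod z - 1) * polar 0 t)%C
      by (transitivity (Cmod z * polar 0 t - polar 0 t)%C;
        [rewrite RtoC_minus; ring | now rewrite <- E]).
    rewrite Cmod_mult, Cmod_polar_0, Cmod_R, Rabs_left; lra. }
destruct (Hpol z1 Z1) as (t & Ht & K1); destruct (Hpol z2 Z2) as (u & Hu & K2).
specialize (H t u z1 z2 Ht Hu ltac:(lra) ltac:(lra) K1 K2); lra.
Qed.

(** * Peak functions *)

(** For [|p| <= 1] the modulus of [(p + p0)^4] is largest at [p = p0]. There a point of Gamma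
    satisfies [s = Cconj s * p0], so [Cconj p0 * (s - s0)^2 = |s - s0|^2] lies in [[0, 16]] and the
    first factor is largest at [s = s0]. Away from [p0] the fourth power outweighs the growth of the
    first factor. *)
Definition peak (s0 p0 : C) (x : C2) : C :=
  ((16 - Cconj p0 * ((fst x - s0) * (fst x - s0))) *
   ((snd x + p0) * (snd x + p0) * ((snd x + p0) * (snd x + p0))))%C.

Lemma peak_holomorphic (s0 p0 : C) :
  holomorphic_algebra symmetrized_bidisc (peak s0 p0).
Proof.
assert (Hd : forall x : C2, @ex_filterdiff C_AbsRing C2 C_NormedModule (peak s0 p0) (locally x)).
{ intros x.
  assert (Hs : @ex_filterdiff C_AbsRing C2 C_NormedModule (fun y => fst y + - s0)%C (locally x)).
  { apply ex_filterdiff_Cplus; [|apply ex_filterdiff_const].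
    eexists; apply filterdiff_linear; apply is_linear_fst. }
  assert (Hp : @ex_filterdiff C_AbsRing C2 C_NormedModule (fun y => snd y + p0)%C (locally x)).
  { apply ex_filterdiff_Cplus; [|apply ex_filterdiff_const].
    eexists; apply filterdiff_linear; apply is_linear_snd. }
  assert (H := ex_filterdiff_Cmult C2
    (fun y => 16 + - Cconj p0 * ((fst y + - s0) * (fst y + - s0)))%C
    (fun y => (snd y + p0) * (snd y + p0) * ((snd y + p0) * (snd y + p0)))%C x).
  destruct H as [l Hl].
  - apply ex_filterdiff_Cplus; [apply ex_filterdiff_const|].
    apply ex_filterdiff_Cmult; [apply ex_filterdiff_const|].
    exact (ex_filterdiff_Cmult C2 _ _ x Hs Hs).
  - assert (Hpp := ex_filterdiff_Cmult C2 _ _ x Hp Hp).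
    exact (ex_filterdiff_Cmult C2 _ _ x Hpp Hpp).
  - exists l; apply filterdiff_ext with (2 := Hl); intros y; unfold peak; cbv beta.
    f_equal; unfold Cminus; ring. }
split.
- apply continuous_on_forall; intros x _; apply filterdiff_continuous, Hd.
- intros x _; apply Hd.
Qed.

(** The defect [s - Cconj s * p] equals [z1 (1 - |z2|^2) + z2 (1 - |z1|^2)], and the moduli of these
    terms add up to [(|z1| + |z2|) (1 - |z1 z2|)]. *)
Lemma symmetrized_bidisc_defect (s p : C) :
  symmetrized_bidisc (s, p) ->
  Cmod s <= 2 /\ Cmod p <= 1 /\ Cmod (s - Cconj s * p) <= 2 * (1 - Cmod p).
Proof.
intros (z1 & z2 & H1 & H2 & E); injection E as Es Ep.
pose proof (Cmod_ge_0 z1) as G1; pose proof (Cmod_ge_0 z2) as G2.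
assert (Hp : Cmod p = Cmod z1 * Cmod z2) by (rewrite Ep; apply Cmod_mult).
split; [|split].
- rewrite Es; eapply Rle_trans; [apply Cmod_triangle|]; lra.
- rewrite Hp; nra.
- replace (s - Cconj s * p)%C with
    (z1 * RtoC (1 - Cmod z2 * Cmod z2) + z2 * RtoC (1 - Cmod z1 * Cmod z1))%C.
  + eapply Rle_trans; [apply Cmod_triangle|].
    rewrite !Cmod_mult, !Cmod_R, !Rabs_pos_eq by nra.
    rewrite Hp.
    replace (Cmod z1 * (1 - Cmod z2 * Cmod z2) + Cmod z2 * (1 - Cmod z1 * Cmod z1))
      with ((Cmod z1 + Cmod z2) * (1 - Cmod z1 * Cmod z2)) by ring.
    apply Rmult_le_compat_r; nra.
  + rewrite !RtoC_minus, <- !Cconj_mult_self, Es, Ep, Cplus_conj; ring.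
Qed.

(* Here [W = |s - s0|^2], [D = |p - p0|^2 / 4], [Q = |p + p0|^2] and [H] is the square
   of the modulus of the first factor of [peak]. *)
Lemma peak_estimate (W D Q H : R) :
  0 <= W -> 0 <= D <= 1 -> 0 <= Q <= 4 * (1 - D) ->
  0 <= H <= 256 * (1 + 4 * D) - 16 * W ->
  65536 <= H * (Q * Q * (Q * Q)) -> W = 0 /\ D = 0.
Proof.
intros HW HD HQ HH Hle.
set (e := 1 - D) in *.
assert (HQQ : 0 <= Q * Q <= 16 * (e * e)) by nra.
assert (HQ4 : 0 <= Q * Q * (Q * Q) <= 256 * (e * e * (e * e))) by nra.
assert (He : 0 <= e <= 1) by (unfold e; lra).
assert (Hee : 0 <= e * e <= 1) by nra.
assert (He4 : 0 <= e * e * (e * e) <= 1) by nra.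
assert (H1 : 256 <= (256 * (1 + 4 * D) - 16 * W) * (e * e * (e * e))) by nra.
(* (1 - D)^4 (1 + 4 D) <= (1 - D)^4 (1 + D)^4 = (1 - D^2)^4 *)
assert (HDD : (1 + 4 * D) * (e * e * (e * e)) <= 1 - D * D).
{ assert (B : 1 + 4 * D <= (1 + D) * (1 + D) * ((1 + D) * (1 + D))) by nra.
  assert (B2 : (1 + 4 * D) * (e * e * (e * e)) <=
    (1 + D) * (1 + D) * ((1 + D) * (1 + D)) * (e * e * (e * e)))
    by (apply Rmult_le_compat_r; lra).
  replace ((1 + D) * (1 + D) * ((1 + D) * (1 + D)) * (e * e * (e * e)))
    with ((1 - D * D) * (1 - D * D) * ((1 - D * D) * (1 - D * D))) in B2 by (unfold e; ring).
  assert (G : 0 <= 1 - D * D <= 1) by nra.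
  assert (G2 : (1 - D * D) * (1 - D * D) <= 1 - D * D) by nra.
  assert (G3 : 0 <= (1 - D * D) * (1 - D * D)) by nra.
  nra. }
assert (HWe : 0 <= W * (e * e * (e * e))) by (apply Rmult_le_pos; lra).
assert (D0 : D = 0) by nra.
split; [|exact D0].
unfold e in *; rewrite D0 in *; nra.
Qed.

Lemma Cmod_sq_zero (z : C) : Cmod z * Cmod z = 0 -> z = RtoC 0.
Proof. intros H; apply Cmod_eq_0; nra. Qed.

(** Squares of moduli reduce the claim to [peak_estimate]. The number [N = |w - p0 Cconj w|]
    vanishes when [p = p0]; in general [N <= 4 |p - p0|], and [N^2 = 2 |w|^2 - 2 Re (Cconj p0 w^2)]
    turns this into a bound on the first factor. *)
Lemma peak_unique_maximum (s0 p0 s p : C) :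
  torus_image (s0, p0) -> symmetrized_bidisc (s, p) ->
  Cmod (peak s0 p0 (s0, p0)) <= Cmod (peak s0 p0 (s, p)) -> (s, p) = (s0, p0).
Proof.
intros H0 H Hle.
apply torus_image_iff in H0; destruct H0 as (Hp0 & Hs0 & Hs0le).
destruct (symmetrized_bidisc_defect s p H) as (Hs & Hp & Hdef).
assert (H128 : Cmod (peak s0 p0 (s0, p0)) = 256).
{ unfold peak; simpl fst; simpl snd.
  replace ((16 - Cconj p0 * ((s0 - s0) * (s0 - s0))) *
    ((p0 + p0) * (p0 + p0) * ((p0 + p0) * (p0 + p0))))%C
    with (RtoC 256 * (p0 * p0 * (p0 * p0)))%C by ring.
  rewrite !Cmod_mult, Hp0, Cmod_R, Rabs_pos_eq; lra. }
rewrite H128 in Hle.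
unfold peak in Hle; simpl fst in Hle; simpl snd in Hle.
set (w := (s - s0)%C) in *.
set (h := (16 - Cconj p0 * (w * w))%C) in *.
rewrite !Cmod_mult in Hle.
(* Parallelogram law, with [|p0| = 1]. *)
assert (EQ : Cmod (p + p0) * Cmod (p + p0) = 2 * (Cmod p * Cmod p) + 2 - Cmod (p - p0) * Cmod (p - p0)).
{ replace 2 with (2 * (Cmod p0 * Cmod p0)) at 2 by (rewrite Hp0; ring).
  rewrite !Cmod_square; destruct p, p0; unfold Re, Im; simpl; ring. }
assert (EH : Cmod h * Cmod h = 256 - 32 * Re (Cconj p0 * (w * w)) +
  Cmod w * Cmod w * (Cmod w * Cmod w)).
{ replace (Cmod w * Cmod w * (Cmod w * Cmod w)) with
    (Cmod (Cconj p0 * (w * w)) * Cmod (Cconj p0 * (w * w)))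
    by (rewrite !Cmod_mult, Cmod_conj, Hp0; ring).
  unfold h; rewrite !Cmod_square; destruct (Cconj p0 * (w * w))%C; unfold Re, Im; simpl; ring. }
assert (EV : Cmod (w - p0 * Cconj w) * Cmod (w - p0 * Cconj w) =
  2 * (Cmod w * Cmod w) - 2 * Re (Cconj p0 * (w * w))).
{ replace (2 * (Cmod w * Cmod w)) with
    (Cmod w * Cmod w + Cmod p0 * Cmod p0 * (Cmod w * Cmod w)) by (rewrite Hp0; ring).
  rewrite !Cmod_square; destruct w, p0; unfold Re, Im; simpl; ring. }
(* Since [s0 = Cconj s0 * p0], only the defect of [(s, p)] and [Cconj s * (p - p0)] remain, and the
   defect is at most [2 (1 - |p|) <= 2 |p - p0|]. *)
assert (HV : Cmod (w - p0 * Cconj w) <= 4 * Cmod (p - p0)).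
{ replace (w - p0 * Cconj w)%C with ((s - Cconj s * p) + Cconj s * (p - p0))%C.
  - eapply Rle_trans; [apply Cmod_triangle|].
    rewrite Cmod_mult, Cmod_conj.
    pose proof (Cmod_triangle p (- (p - p0))) as T; rewrite Cmod_opp in T.
    replace (p + - (p - p0))%C with p0 in T by ring.
    pose proof (Cmod_ge_0 (p - p0)).
    assert (Cmod s * Cmod (p - p0) <= 2 * Cmod (p - p0)) by (apply Rmult_le_compat_r; lra).
    lra.
  - unfold w; rewrite Cminus_conj.
    transitivity (s - p0 * Cconj s - (s0 - Cconj s0 * p0))%C; [|ring].
    rewrite <- Hs0; ring. }
assert (Hw : Cmod w <= 4).
{ unfold w, Cminus; eapply Rle_trans; [apply Cmod_triangle|]; rewrite Cmod_opp; lra. }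
pose proof (Cmod_ge_0 w) as Gw; pose proof (Cmod_ge_0 (p - p0)) as Gp.
pose proof (Cmod_ge_0 (p + p0)) as Gq; pose proof (Cmod_ge_0 h) as Gh.
pose proof (Cmod_ge_0 p) as Gpp.
pose proof (Cmod_ge_0 (w - p0 * Cconj w)) as Gv.
set (N := Cmod (w - p0 * Cconj w)) in *.
assert (HVV : N * N <= 16 * (Cmod (p - p0) * Cmod (p - p0))) by nra.
assert (Hpp : Cmod p * Cmod p <= 1) by nra.
assert (HWW : Cmod w * Cmod w * (Cmod w * Cmod w) <= 16 * (Cmod w * Cmod w))
  by (apply Rmult_le_compat_r; nra).
pose proof (Rle_0_sqr (Cmod w)) as S1; pose proof (Rle_0_sqr (Cmod (p - p0))) as S2.
pose proof (Rle_0_sqr (Cmod (p + p0))) as S3; pose proof (Rle_0_sqr (Cmod h)) as S4.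
unfold Rsqr in S1, S2, S3, S4.
destruct (peak_estimate (Cmod w * Cmod w) (Cmod (p - p0) * Cmod (p - p0) / 4)
  (Cmod (p + p0) * Cmod (p + p0)) (Cmod h * Cmod h)) as [EW ED].
- lra.
- lra.
- lra.
(* Here [|h|^2 = 256 - 32 |w|^2 + 16 N^2 + |w|^4], with [N^2 <= 16 |p - p0|^2] and
   [|w|^4 <= 16 |w|^2]. *)
- split; [lra|]; rewrite EH; lra.
- set (q := Cmod (p + p0)) in *; set (m := Cmod h) in *.
  replace (m * m * (q * q * (q * q) * (q * q * (q * q))))
    with (m * (q * q * (q * q)) * (m * (q * q * (q * q)))) by ring.
  apply Rle_trans with (256 * 256); [lra|].
  apply Rmult_le_compat; lra.
- assert (E1 : w = RtoC 0) by (now apply Cmod_sq_zero).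
  assert (E2 : (p - p0)%C = RtoC 0) by (apply Cmod_sq_zero; lra).
  f_equal.
  + transitivity (w + s0)%C; [unfold w; ring | rewrite E1; ring].
  + transitivity (p - p0 + p0)%C; [ring | rewrite E2; ring].
Qed.

(** * The distinguished boundary is the image of the torus *)

Theorem lemma5p1 (s p : C) :
  distinguished_boundary (s, p) <->
  s = (Cconj s * p)%C /\ (Cmod (s ^ 2 - 4 * p)%C + Cmod s ^ 2 = 4)%R.
Proof.
rewrite <- torus_image_equations.
assert (Hsub : forall x, torus_image x -> symmetrized_bidisc x).
{ intros x (z1 & z2 & H1 & H2 & ->); exists z1, z2; repeat split; lra. }
split.
(* The image of the torus is itself a closed boundary, so it contains the intersection of all of
   them. *)
- intros H; apply H; split; [exact torus_image_closed | split; [exact Hsub|]].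
  exact torus_image_maximum.
(* Any closed boundary contains a point where [|peak s p|] attains its maximum over Gamma, and that
   point can only be [(s, p)]. *)
- intros H E (_ & HE & Hmax).
  destruct (Hmax _ (peak_holomorphic s p)) as ([s' p'] & Hx & Hle).
  rewrite <- (peak_unique_maximum s p s' p' H (HE _ Hx) (Hle _ (Hsub _ H))).
  exact Hx.
Qed.
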